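(* Let $\mathcal{F}$ be a finite family of graphs with $\min_{F\in\mathcal{F}}\chi(F)=r+1\geq 3$, and set $t=\max_{F\in\mathcal{F}}|F|$. Assume that $F_1\subseteq P_t\vee T(t(r-1),r-1)$ and $F_2\subseteq tK_2\vee tK_2\vee T(t(r-2),r-2)$ for some $F_1,F_2\in\mathcal{F}$. Then there exist a constant $M_0$ and a function $g(n)$ with $g(n)\to\infty$ as $n\to\infty$ (both depending only on $\mathcal{F}$) such that, for all sufficiently large $n$, every graph $G\in\mathrm{SPEX}(n,\mathcal{F})$ has a partition $V(G)=\bigcup_{1\leq i\leq r}S_i$ satisfying: (i) for every $1\leq i\leq r$, $|S_i|\geq g(n)$ (that is, $|S_i|\to\infty$ when $n\to\infty$); (ii) for every $2\leq i\leq r$, there exists $S_i'\subseteq S_i$ such that $|S_i-S_i'|\leq M_0$, and $N_G(v)=V(G)-S_i$ for every $v\in S_i'$.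
   Context: All graphs are finite, undirected, simple. $|F|$ is the number of vertices of $F$, $\chi(F)$ its chromatic number, and $N_G(v)$ the set of neighbors of $v$ in $G$. $F\subseteq G$ means $G$ contains a copy of $F$ as a (not necessarily induced) subgraph. $P_n$, $K_n$ are the path and complete graph on $n$ vertices; $tH$ is the disjoint union of $t$ copies of $H$; $G_1\vee G_2\vee\cdots$ denotes the join (disjoint union together with all edges between different $G_i$; the paper writes $\prod$). $T(n,r)$ is the Turán graph, i.e. the complete $r$-partite graph on $n$ vertices whose parts each have size $\lfloor n/r\rfloor$ or $\lceil n/r\rceil$; $T(n,1)=\overline{K_n}$, and $T(n,0)$ is the graph with no vertices. The spectral radius $\rho(G)$ is the largest eigenvalue of the adjacency matrix. $\mathrm{SPEX}(n,\mathcal{F})$ is the set of graphs with maximum spectral radius among all graphs of order $n$ containing no member of $\mathcal{F}$ as a subgraph. *)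

(* Defs.v *)
From mathcomp Require Import all_boot all_order all_algebra.
From mathcomp Require Import classical_sets filter reals.

Set Implicit Arguments.
Unset Strict Implicit.
Unset Printing Implicit Defensive.

Import Order.TTheory GRing.Theory Num.Theory.

Record sgraph := SGraph {
  vertex :> finType;
  adj : rel vertex;
  adj_sym : symmetric adj;
  adj_irrefl : irreflexive adj }.

Definition neighbors (G : sgraph) (v : G) : {set G} := [set w | adj v w].

(* [H] is a subgraph, not necessarily induced, of [G]. *)
Definition contains (G H : sgraph) : Prop :=
  exists2 f : H -> G, injective f & forall x y, adj x y -> adj (f x) (f y).

Definition colorable (G : sgraph) (k : nat) : bool :=
  [exists f : {ffun G -> 'I_k}, forall x, forall y, adj x y ==> (f x != f y)].

Lemma colorable_card (G : sgraph) : exists k, colorable G k.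
Proof.
exists #|G|; apply/existsP; exists [ffun x => enum_rank x].
apply/forallP=> x; apply/forallP=> y; apply/implyP; rewrite !ffunE.
by apply: contraTneq => /enum_rank_inj->; rewrite adj_irrefl.
Qed.

Definition chromatic_number (G : sgraph) : nat := ex_minn (colorable_card G).

Definition min_chromatic (I : finType) (F : I -> sgraph) (k : nat) : Prop :=
  (exists i, chromatic_number (F i) = k) /\
  (forall i, k <= chromatic_number (F i)).

Definition complete_rel n : rel 'I_n := fun i j => i != j.

Lemma complete_rel_sym n : symmetric (@complete_rel n).
Proof. by move=> i j; rewrite /complete_rel eq_sym. Qed.

Lemma complete_rel_irrefl n : irreflexive (@complete_rel n).
Proof. by move=> i; rewrite /complete_rel eqxx. Qed.

Definition complete_graph n : sgraph :=
  SGraph (@complete_rel_sym n) (@complete_rel_irrefl n).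

Definition path_rel n : rel 'I_n :=
  fun i j => (i.+1 == j :> nat) || (j.+1 == i :> nat).

Lemma path_rel_sym n : symmetric (@path_rel n).
Proof. by move=> i j; rewrite /path_rel orbC. Qed.

Lemma path_rel_irrefl n : irreflexive (@path_rel n).
Proof. by move=> i; rewrite /path_rel eqn_leq ltnn. Qed.

Definition path_graph n : sgraph :=
  SGraph (@path_rel_sym n) (@path_rel_irrefl n).

(* For [0 < r] the parts are the residue classes modulo [r], and each of them
   has [n %/ r] or [(n %/ r).+1] elements, the latter only if [r] does not
   divide [n]. *)
Definition turan_rel n r : rel 'I_n := fun i j => i != j %[mod r].

Lemma turan_rel_sym n r : symmetric (@turan_rel n r).
Proof. by move=> i j; rewrite /turan_rel eq_sym. Qed.

Lemma turan_rel_irrefl n r : irreflexive (@turan_rel n r).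
Proof. by move=> i; rewrite /turan_rel eqxx. Qed.

(* [turan_graph n 0] is the graph without vertices, for every [n]; the case
   distinction is needed because [i %% 0 = i]. *)
Definition turan_graph n r : sgraph :=
  if r is 0 then complete_graph 0
  else SGraph (@turan_rel_sym n r) (@turan_rel_irrefl n r).

Definition join_rel (G H : sgraph) : rel (G + H)%type := fun u v =>
  match u, v with
  | inl x, inl y => adj x y
  | inr x, inr y => adj x y
  | _, _ => true
  end.

Lemma join_rel_sym (G H : sgraph) : symmetric (@join_rel G H).
Proof. by move=> [x|x] [y|y] //=; rewrite adj_sym. Qed.

Lemma join_rel_irrefl (G H : sgraph) : irreflexive (@join_rel G H).
Proof. by move=> [x|x] /=; rewrite adj_irrefl. Qed.

Definition join (G H : sgraph) : sgraph :=
  SGraph (@join_rel_sym G H) (@join_rel_irrefl G H).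

Definition copies_rel t (H : sgraph) : rel ('I_t * H)%type := fun u v =>
  (u.1 == v.1) && adj u.2 v.2.

Lemma copies_rel_sym t (H : sgraph) : symmetric (@copies_rel t H).
Proof. by move=> u v; rewrite /copies_rel eq_sym adj_sym. Qed.

Lemma copies_rel_irrefl t (H : sgraph) : irreflexive (@copies_rel t H).
Proof. by move=> u; rewrite /copies_rel adj_irrefl andbF. Qed.

Definition copies t (H : sgraph) : sgraph :=
  SGraph (@copies_rel_sym t H) (@copies_rel_irrefl t H).

Definition adjacency_matrix (R : nzRingType) (G : sgraph) : 'M[R]_#|G| :=
  (\matrix_(i, j) (adj (enum_val i) (enum_val j))%:R)%R.

(* The set of eigenvalues is finite, and nonempty if [G] has a vertex because
   the adjacency matrix is real symmetric; the supremum is then its largest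
   element. *)
Definition spectral_radius (R : realType) (G : sgraph) : R :=
  sup [set a | eigenvalue (adjacency_matrix R G) a]%classic.

Definition family_free (I : finType) (F : I -> sgraph) (G : sgraph) : Prop :=
  forall i, ~ contains G (F i).

Definition SPEX (R : realType) (n : nat) (I : finType) (F : I -> sgraph)
    (G : sgraph) : Prop :=
  [/\ #|G| = n, family_free F G &
      forall H : sgraph, #|H| = n -> family_free F H ->
        (spectral_radius R H <= spectral_radius R G)%R].

(* Main.v *)
(** Let [rho] be the spectral radius of an extremal graph [G] of order [n], [x] its
Perron vector with largest entry [1], and [N v] the neighbourhood of [v].

Since the Turan graph is admissible, [rho >= (1 - 1/r) n - 1]. A set [U] of vertices
that maximises [rho(G[U]) - beta |U|], for [beta] slightly below [1 - 1/r], induces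
a subgraph of minimum degree about [(1 - 1/r) |U|], and it is almost all of [G],
because [rho(G[U]) <= (1 - 1/r + o(1)) |U|]. It contains [K_r(s)] for a large
constant [s]; sorting the vertices by their neighbours in this [K_r(s)] gives [r]
almost completely joined parts, and each of them is [P_t]-free as [F_1] is forbidden.

Call a set [N] rich if every set [Q] of [t] vertices misses some [u] with
[N :&: Q] contained in [N u]. Making a rich [N] the neighbourhood of a vertex [v]
creates no forbidden subgraph, so by extremality the [x]-weight of [N v] is at least
that of [N], with equality only if [N v = N]. Hence all entries of [x] are at least
[1/4], all but boundedly many vertices (the hubs) lie in one of [r] parts, a vertex
[v] of a part [V i] misses at most [4 (d + b)] vertices of the other parts, where
[d] is the degree of [v] in [V i] and [b] bounds the number of hubs, and two
nonadjacent vertices with rich neighbourhoods are twins.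

A sunflower argument shows that among many vertices of [V i] with equal traces on
[V i] and on the hubs there is one with a rich neighbourhood. As [V i] is
[P_t]-free, few traces occur unless [V i] contains a large matching of vertices of
bounded degree in [V i]. Without such a matching all but boundedly many vertices of
[V i] are therefore twins, with neighbourhood [~: V i]. Two parts with such
matchings would contain a copy of [F_2], so there is at most one, which, together
with the hubs, is taken as the first part. *)
Require Import Defs.
From mathcomp Require Import all_boot all_order all_algebra.
From mathcomp Require Import zify ring lra.
From mathcomp Require boolp classical_sets filter topology function_spaces.
From mathcomp Require normedtype derive.

Set Implicit Arguments.
Unset Strict Implicit.
Unset Printing Implicit Defensive.

(** * Subgraph embeddings *)

Section Embeddings.
Variable G : sgraph.
Implicit Types (A B X : {set G}).

Definition joined A B := forall u v, u \in A -> v \in B -> adj u v.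

Definition hom (H : sgraph) (f : H -> G) :=
  injective f /\ forall x y, adj x y -> adj (f x) (f y).

Lemma hom_contains (H : sgraph) (f : H -> G) : hom f -> contains G H.
Proof. by case=> fi fa; exists f. Qed.

Lemma contains_trans (K H : sgraph) : contains G K -> contains K H -> contains G H.
Proof.
move=> [f fi fa] [g gi ga]; exists (f \o g); first exact: inj_comp.
by move=> x y /ga/fa.
Qed.

Lemma hom_join (H1 H2 : sgraph) (f1 : H1 -> G) (f2 : H2 -> G) :
  hom f1 -> hom f2 -> (forall x y, adj (f1 x) (f2 y)) ->
  hom (fun z : join H1 H2 => match z with inl x => f1 x | inr y => f2 y end).
Proof.
move=> [i1 a1] [i2 a2] a12; split.
  have ne x y : f1 x != f2 y.
    by apply: contraTneq (a12 x y) => ->; rewrite adj_irrefl.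
  move=> [x|x] [y|y] => [/i1->//|/eqP|/esym/eqP|/i2->//].
    by rewrite (negPf (ne _ _)).
  by rewrite (negPf (ne _ _)).
move=> [x|x] [y|y] //=; [exact: a1|by rewrite adj_sym|exact: a2].
Qed.

Lemma hom_path t (p : seq G) : size p = t -> uniq p -> sorted (@adj G) p ->
  exists2 f : path_graph t -> G, hom f & forall x, f x \in p.
Proof.
case: t p => [|t] p sp up adjp.
  by exists (fun x : 'I_0 => match x with Ordinal _ h => match notF h with end end);
    [split|]; case.
have [x0 _] : exists x0, x0 \in p by case: p sp {up adjp} => // x p _; exists x; rewrite mem_head.
exists (fun i : 'I_t.+1 => nth x0 p i) => [|i]; last by rewrite mem_nth // sp.
split=> [i j /eqP|i j].
  by rewrite nth_uniq ?sp // => /eqP/val_inj.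
have stp k l : l < t.+1 -> k.+1 = l -> adj (nth x0 p k) (nth x0 p l).
  by move=> lt E; subst l; apply: (sortedP x0 adjp); rewrite sp.
by case/orP => /eqP E; [|rewrite adj_sym]; apply: stp.
Qed.

Lemma hom_turan t m (A : nat -> {set G}) :
  (forall i, i < m -> t <= #|A i|) ->
  (forall i k, i < m -> k < m -> i != k -> joined (A i) (A k)) ->
  exists2 f : turan_graph (t * m) m -> G, hom f &
    forall x, exists2 i, i < m & f x \in A i.
Proof.
case: m => [|m] tA jA.
  by exists (fun x : 'I_0 => match x with Ordinal _ h => match notF h with end end);
    [split|]; case.
case: t tA => [|t] tA.
  by exists (fun x : 'I_(0 * m.+1) => match x with Ordinal _ h => match notF h with end end);
    [split|]; case.
have [x0 _] : exists x0, x0 \in A 0 by apply/card_gt0P; apply: leq_trans (tA 0 _).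
have lt k : k < t.+1 * m.+1 -> (k %% m.+1 < m.+1) && (k %/ m.+1 < #|A (k %% m.+1)|).
  move=> kl; rewrite ltn_mod /=; apply: leq_trans (tA _ _); last by rewrite ltn_mod.
  by rewrite ltn_divLR.
exists (fun k : 'I_(t.+1 * m.+1) => nth x0 (enum (A (k %% m.+1))) (k %/ m.+1)).
  have inA (k : 'I_(t.+1 * m.+1)) :
    nth x0 (enum (A (k %% m.+1))) (k %/ m.+1) \in A (k %% m.+1).
    by rewrite -mem_enum mem_nth // -cardE; case/andP: (lt k (ltn_ord k)).
  have ad (k l : 'I_(t.+1 * m.+1)) : k != l %[mod m.+1] ->
    adj (nth x0 (enum (A (k %% m.+1))) (k %/ m.+1))
        (nth x0 (enum (A (l %% m.+1))) (l %/ m.+1)).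
    by move=> kl; apply: (jA (k %% m.+1) (l %% m.+1)); rewrite ?ltn_mod.
  split=> [k l|k l /ad //]; have [E|/ad] := eqVneq (k %% m.+1) (l %% m.+1).
    rewrite E => /eqP; rewrite nth_uniq ?enum_uniq //.
    - by move=> /eqP E'; apply: val_inj; rewrite /= (divn_eq k m.+1) (divn_eq l m.+1) E E'.
    - by rewrite -cardE -E; case/andP: (lt k (ltn_ord k)).
    - by rewrite -cardE; case/andP: (lt l (ltn_ord l)).
  by move=> + E; rewrite E adj_irrefl.
move=> k; exists (k %% m.+1); first by rewrite ltn_mod.
by rewrite -mem_enum mem_nth // -cardE; case/andP: (lt k (ltn_ord k)).
Qed.

Definition matching X (M : seq (G * G)) :=
  [/\ uniq (unzip1 M ++ unzip2 M), {subset unzip1 M ++ unzip2 M <= X} &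
      forall e, e \in M -> adj e.1 e.2].

Lemma hom_copies t X M : matching X M -> size M = t ->
  exists2 f : copies t (complete_graph 2) -> G, hom f & forall x, f x \in X.
Proof.
case=> uM MX aM sM; case: t sM => [|t] sM.
  by exists (fun x : 'I_0 * 'I_2 => match x.1 with Ordinal _ h => match notF h with end end);
    [split|]; case; case.
have [x0 _] : exists x0, x0 \in M by case: M sM {uM MX aM} => // x M _; exists x; rewrite mem_head.
set s := unzip1 M ++ unzip2 M.
have ss : size s = t.+1 * 2 by rewrite size_cat !size_map sM; lia.
have ls (x : 'I_t.+1 * 'I_2) : x.2 * t.+1 + x.1 < size s.
  by case: x => i j; have := ltn_ord i; have := ltn_ord j => /=; rewrite ss; nia.
exists (fun x : 'I_t.+1 * 'I_2 => nth x0.1 s (x.2 * t.+1 + x.1)) => [|x]; last first.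
  by apply: MX; apply: mem_nth.
split=> [x y /eqP|[i j] [i' j'] /=].
  rewrite nth_uniq //; case: x y => [i j] [i' j'] /= /eqP E.
  have E1 := congr1 (modn^~ t.+1) E; rewrite /= !modnMDl !modn_small // in E1.
  have ij : i = i' by apply: val_inj.
  move: E; rewrite ij => /addIn/eqP; rewrite eqn_pmul2r // => /eqP E.
  by congr (_, _); apply: val_inj.
have E0 : nth x0.1 s i = (nth x0 M i).1.
  by rewrite nth_cat size_map sM ltn_ord (nth_map x0) ?sM.
have E1 : nth x0.1 s (t.+1 + i) = (nth x0 M i).2.
  by rewrite nth_cat size_map sM ltnNge leq_addr /= addKn (nth_map x0) ?sM.
have ad : adj (nth x0 M i).1 (nth x0 M i).2 by apply: aM; rewrite mem_nth ?sM.
rewrite /copies_rel /= => /andP[/eqP <-] {i'}.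
case: j j' => [[|[|//]] hj] [[|[|//]] hj'] //= _.
  by rewrite mul0n add0n mul1n E0 E1.
by rewrite mul0n add0n mul1n E0 E1 adj_sym.
Qed.

Definition path_multipartite t m := exists (p : seq G) (A : nat -> {set G}),
  [/\ size p = t, uniq p, sorted (@adj G) p, forall i, i < m -> t <= #|A i| &
     (forall i k, i < m -> k < m -> i != k -> joined (A i) (A k)) /\
     (forall i, i < m -> joined [set x in p] (A i))].

Lemma contains_path_turan t m : path_multipartite t m ->
  contains G (join (path_graph t) (turan_graph (t * m) m)).
Proof.
move=> [p [A [sp up adjp tA [jA pA]]]].
have [f1 h1 f1p] := hom_path sp up adjp; have [f2 h2 f2A] := hom_turan tA jA.
apply: hom_contains (hom_join h1 h2 _).
by move=> x y; have [i im yA] := f2A y; apply: (pA i); rewrite ?inE.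
Qed.

Definition matchings_multipartite t m := exists (M1 M2 : seq (G * G)) (A : nat -> {set G}),
  [/\ exists X1 X2, [/\ matching X1 M1, matching X2 M2, joined X1 X2 &
        forall i, i < m -> joined X1 (A i) /\ joined X2 (A i)],
      size M1 = t, size M2 = t, forall i, i < m -> t <= #|A i| &
      forall i k, i < m -> k < m -> i != k -> joined (A i) (A k)].

Lemma contains_matchings_turan t m : matchings_multipartite t m ->
  contains G (join (copies t (complete_graph 2))
    (join (copies t (complete_graph 2)) (turan_graph (t * m) m))).
Proof.
move=> [M1 [M2 [A [[X1 [X2 [m1 m2 j12 jXA]]] s1 s2 tA jA]]]].
have [f1 h1 f1X] := hom_copies m1 s1; have [f2 h2 f2X] := hom_copies m2 s2.
have [f3 h3 f3A] := hom_turan tA jA.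
apply: hom_contains (hom_join h1 (hom_join h2 h3 _) _) => [x y|x [y|y]].
- by have [i im yA] := f3A y; apply: (jXA i im).2.
- exact: j12.
by have [i im yA] := f3A y; apply: (jXA i im).1.
Qed.

End Embeddings.

(** * The Erdos-Stone argument *)

Lemma pigeonhole (T T' : finType) (W : {set T}) (C : {set T'}) (f : T -> T') m :
  (forall w, w \in W -> f w \in C) -> m * #|C| < #|W| ->
  exists2 y, y \in C & m < #|[set w in W | f w == y]|.
Proof.
move=> fC mC; apply/exists_inP; apply: contraLR mC.
rewrite negb_exists_in => /forall_inP small; rewrite -leqNgt.
rewrite -sum1_card (partition_big f [in C]) //= mulnC -sum_nat_const.
apply: leq_sum => y /small; rewrite -leqNgt; apply: leq_trans.
by rewrite -sum1_card; apply/eq_leq/eq_bigl => w; rewrite !inE.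
Qed.

Lemma exists_subset (T : finType) (B : {set T}) k : k <= #|B| ->
  exists2 A : {set T}, A \subset B & #|A| = k.
Proof.
move=> kB; exists [set x in take k (enum B)].
  by apply/subsetP => x; rewrite inE => /mem_take; rewrite mem_enum.
rewrite cardsE; have /card_uniqP -> : uniq (take k (enum B)) by rewrite take_uniq ?enum_uniq.
by rewrite size_takel // -cardE.
Qed.

Lemma card_bigcup_le (T : finType) j s (A : nat -> {set T}) :
  (forall i, i < j -> #|A i| <= s) -> #|\bigcup_(i < j) A i| <= j * s.
Proof.
move=> As; elim: j As => [|j IH] As; first by rewrite big_ord0 cards0.
rewrite big_ord_recr /= mulSn addnC; apply: leq_trans (leq_card_setU _ _) _.
by apply: leq_add; [apply: IH => i ij; apply: As; lia|apply: As].
Qed.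

Section Multipartite.
Variable G : sgraph.
Implicit Types (A : nat -> {set G}) (U W X : {set G}).

Definition multipartite j s A U :=
  (forall i, i < j -> A i \subset U /\ #|A i| = s) /\
  (forall i k, i < j -> k < j -> i != k -> joined (A i) (A k)).

Lemma joined_sym X W : joined X W -> joined W X.
Proof. by move=> j u v uW vX; rewrite adj_sym; apply: j. Qed.

Lemma joinedS X X' W W' : X' \subset X -> W' \subset W -> joined X W -> joined X' W'.
Proof. by move=> /subsetP sX /subsetP sW j u v /sX uX /sW; apply: j. Qed.

Lemma card_nonadj X W :
  \sum_(w in W) #|X :\: neighbors w| = \sum_(u in X) #|W :\: neighbors u|.
Proof.
have E X' w : #|X' :\: neighbors w| = \sum_(u in X') ~~ adj w u.
  rewrite -sum1_card (eq_bigl (fun u => (u \in X') && ~~ adj w u)); last first.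
    by move=> u; rewrite !inE andbC.
  by rewrite big_mkcondr; apply: eq_bigr => u _; case: adj.
rewrite (eq_bigr _ (fun w _ => E X w)) exchange_big /=.
apply: eq_bigr => u _; rewrite E; apply: eq_bigr => w _.
by rewrite adj_sym.
Qed.

Lemma fiber_extend j s s' A U W : multipartite j s' A U -> W \subset U ->
  (forall w i, w \in W -> i < j -> s <= #|A i :&: neighbors w|) ->
  s * 2 ^ (j * s') < #|W| -> exists A', multipartite j.+1 s A' U.
Proof.
move=> [AU jA] WU sW cW; pose J := \bigcup_(i < j) A i.
have AJ i : i < j -> A i \subset J.
  by move=> ij; apply: (bigcup_sup (Ordinal ij)).
have trC w : w \in W -> J :&: neighbors w \in powerset J by rewrite powersetE subsetIl.
have cC : s * #|powerset J| < #|W|.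
  rewrite card_powerset; apply: leq_ltn_trans cW; rewrite leq_mul2l; apply/orP; right.
  by rewrite leq_exp2l //; apply: card_bigcup_le => i /AU[_ ->].
have [tr _ cf] := pigeonhole trC cC.
set Wf := [set w in W | _] in cf.
have [w0 w0W] : exists w0, w0 \in Wf by apply/card_gt0P; lia.
have st i : i < j -> s <= #|A i :&: tr|.
  move=> ij; move: w0W; rewrite inE => /andP[w0W /eqP <-].
  by rewrite setIA (setIidPl (AJ i ij)); apply: sW.
have trW : joined tr Wf.
  move=> u w ut; rewrite inE => /andP[_ /eqP Ew]; move: ut; rewrite -Ew !inE adj_sym.
  by case/andP.
have [B BW cB] := exists_subset (ltnW cf).
have [f fP] : exists f : nat -> {set G}, forall i, i < j -> f i \subset A i :&: tr /\ #|f i| = s.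
  exists (fun i => [set x in take s (enum (A i :&: tr))]) => i /st sA.
  split; first by apply/subsetP => x; rewrite inE => /mem_take; rewrite mem_enum.
  rewrite cardsE; have /card_uniqP -> : uniq (take s (enum (A i :&: tr))).
    by rewrite take_uniq ?enum_uniq.
  by rewrite size_takel // -cardE.
exists (fun i => if i < j then f i else B); split.
  move=> i ij; case: ifP => [lt|_].
    have [fA cfi] := fP i lt; split=> //.
    by apply: subset_trans fA (subset_trans (subsetIl _ _) (AU i lt).1).
  split=> //; apply: subset_trans BW _; apply: subset_trans _ WU.
  by apply/subsetP => x; rewrite inE => /andP[].
have fB i : i < j -> joined (f i) B.
  move=> /fP[fA _]; apply: joinedS trW => //.
  by apply: subset_trans fA (subsetIr _ _).
move=> i k ij kj ik; case: ifP => hi; case: ifP => hk.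
- apply: joinedS (jA i k hi hk ik).
    by apply: subset_trans (fP i hi).1 (subsetIl _ _).
  by apply: subset_trans (fP k hk).1 (subsetIl _ _).
- exact: fB.
- by apply: joined_sym; apply: fB.
- by move: ij kj ik hi hk; lia.
Qed.

End Multipartite.

(* The hypothesis says that every vertex of [U] has at least
   [(1 - 1/j + 1/q) * #|U|] neighbours in [U]. *)
Lemma erdos_stone j q s : exists n0, forall (G : sgraph) (U : {set G}), n0 <= #|U| ->
  (forall v, v \in U -> q * j * #|U :\: neighbors v| + j * #|U| <= q * #|U|) ->
  exists A, multipartite j.+1 s A U.
Proof.
elim: j s => [|j IH] s.
  exists s => G U sU _; have [B BU cB] := exists_subset sU.
  exists (fun=> B); split=> [//|i k i1 k1].
  by move=> /eqP; lia.
case: s => [|s].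
  exists 0 => G U _ _; exists (fun=> set0); split=> [i _|i k _ _ _ u v]; rewrite ?inE //.
  by rewrite sub0set cards0.
have [n0 n0P] := IH (2 * q * s.+1).
set s1 := 2 * q * s.+1 in n0P; exists (n0 + (2 * q * (s.+1 * 2 ^ (j.+1 * s1)) + 1)) => G U nU deg.
have [||A mA] := n0P G U; first by lia.
  by move=> v /deg; nia.
set k := #|U| in nU deg.
pose Wd := [set w in U | [forall i : 'I_j.+1, s.+1 <= #|A i :&: neighbors w|]].
apply: (fiber_extend (W := Wd) mA).
- by apply/subsetP => w; rewrite inE => /andP[].
- by move=> w i; rewrite inE => /andP[_ /forallP h] ij; apply: (h (Ordinal ij)).
have low w : w \in U :\: Wd -> s1 - s.+1 <= \sum_(i < j.+1) #|A i :\: neighbors w|.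
  rewrite !inE => /andP[+ wU]; rewrite wU /= => /forallPn[i]; rewrite -ltnNge => lt.
  rewrite (bigD1 i) //=; have [_ ci] := mA.1 i (ltn_ord i).
  have := cardsID (neighbors w) (A i); rewrite ci; lia.
have H1 : \sum_(w in U :\: Wd) (s1 - s.+1) <=
          \sum_(w in U :\: Wd) \sum_(i < j.+1) #|A i :\: neighbors w|.
  exact: leq_sum.
rewrite sum_nat_const in H1.
have H2 : \sum_(w in U :\: Wd) \sum_(i < j.+1) #|A i :\: neighbors w| <=
          \sum_(w in U) \sum_(i < j.+1) #|A i :\: neighbors w|.
  by rewrite [leqRHS](big_setID Wd) /= leq_addl.
have {}H1 := leq_trans H1 H2.
move: H1; rewrite exchange_big /= => H1.
have H3 : q * j.+1 * (\sum_(i < j.+1) \sum_(w in U) #|A i :\: neighbors w|) <=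
   j.+1 * (s1 * (q * k - j.+1 * k)).
  apply: (@leq_trans (\sum_(i < j.+1) s1 * (q * k - j.+1 * k))); last first.
    by rewrite sum_nat_const card_ord.
  rewrite big_distrr /=; apply: leq_sum => i _; rewrite card_nonadj big_distrr /=.
  have [AU ci] := mA.1 i (ltn_ord i); move/subsetP: AU => AU.
  rewrite -ci -sum_nat_const.
  by apply: leq_sum => u /AU/deg; lia.
have cU : #|U :\: Wd| = k - #|Wd|.
  by rewrite cardsDS //; apply/subsetP => w; rewrite inE => /andP[].
move: H1 H3; set S := \sum_(i < _) _; rewrite cU => H1 H3.
have q0 : 0 < q.
  rewrite lt0n; apply/eqP => q0.
  have [u0 u0U] : exists u0, u0 \in U by apply/card_gt0P; rewrite -/k; lia.
  by have := deg u0 u0U; rewrite q0 !mul0n add0n leqn0 muln_eq0 /= -/k; lia.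
have H4 : q * S <= s1 * (q * k - j.+1 * k).
  by rewrite -(leq_pmul2l (ltn0Sn j)); lia.
rewrite ltnNge; apply/negP => cW.
have kW : 2 * q * #|Wd| < k.
  by have : 2 * q * #|Wd| <= 2 * q * (s.+1 * 2 ^ (j.+1 * s1)); [rewrite leq_mul2l cW orbT|lia].
have E1 : s1 - s.+1 = s.+1 * (2 * q - 1) by rewrite /s1; nia.
have H5 : (k - #|Wd|) * (2 * q - 1) <= 2 * (q * k - k).
  rewrite -(leq_pmul2l (ltn0Sn s)) -(leq_pmul2l q0).
  apply: (@leq_trans (q * S)); first by rewrite leq_mul2l; apply/orP; right; move: H1; rewrite E1; lia.
  apply: leq_trans H4 _; rewrite /s1.
  have -> : q * (s.+1 * (2 * (q * k - k))) = 2 * q * s.+1 * (q * k - k) by lia.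
  by rewrite leq_mul2l; apply/orP; right; rewrite mulSn; lia.
by move: H5 kW q0; clear; nia.
Qed.

(** * Graphs without long paths *)

Section PathFree.
Variable G : sgraph.
Implicit Types (A : nat -> {set G}) (U W X : {set G}).

Definition has_path t X := exists p : seq G,
  [/\ size p = t, uniq p, sorted (@adj G) p & {subset p <= X}].

Lemma greedy_path t X : X != set0 ->
  (forall v, v \in X -> t <= #|X :&: neighbors v|) -> has_path t X.
Proof.
move=> /set0Pn[x0 x0X] deg.
suff H : forall m, m <= t -> exists x p,
    [/\ size p = m, uniq (x :: p), path (@adj G) x p & {subset x :: p <= X}].
  have [x [p [sp up ap pX]]] := H t (leqnn t); exists p; split=> //; first by case/andP: up.
    exact: path_sorted ap.
  by move=> z zp; apply: pX; rewrite inE zp orbT.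
elim=> [_|m IH mt]; first by exists x0, [::]; split=> // z; rewrite inE => /eqP->.
have [x [p [sp up ap pX]]] := IH (ltnW mt).
have /subsetPn[y] : ~~ (X :&: neighbors x \subset [set z in p]).
  have cp : #|[set z in p]| <= m by rewrite cardsE -sp card_size.
  apply/negP => /subset_leq_card/leq_trans/(_ cp).
  have := deg x (pX x (mem_head _ _)); lia.
rewrite !inE => /andP[yX xy] yp; exists y, (x :: p); split=> //=.
- by rewrite sp.
- rewrite inE negb_or yp andbT; apply/andP; split=> //.
  by apply: contraTneq xy => ->; rewrite adj_irrefl.
- by rewrite adj_sym xy.
- by move=> z; rewrite inE => /orP[/eqP->|/pX].
Qed.

Lemma has_pathS t X W : X \subset W -> has_path t X -> has_path t W.
Proof. by move=> /subsetP XW [p [? ? ? pX]]; exists p; split=> // z /pX/XW. Qed.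

Lemma path_free_degree_sum t X : ~ has_path t X ->
  \sum_(v in X) #|X :&: neighbors v| <= 2 * t * #|X|.
Proof.
move En: #|X| => n; elim: n X En => [|n IH] X cX nX.
  by rewrite (cards0_eq cX) big_set0.
have [v vX dv] : exists2 v, v \in X & #|X :&: neighbors v| < t.
  apply/exists_inP; apply: contra_notT nX; rewrite negb_exists_in => /forall_inP h.
  apply: greedy_path; first by rewrite -card_gt0 cX.
  by move=> v /h; rewrite -leqNgt.
have cX' : #|X :\ v| = n by have := cardsD1 v X; rewrite vX cX; lia.
have nX' : ~ has_path t (X :\ v) by move/(has_pathS (subsetDl _ _)).
have {IH} := IH _ cX' nX'.
rewrite (big_setD1 v vX) /= => IH.
have -> : \sum_(u in X :\ v) #|X :&: neighbors u| =
    \sum_(u in X :\ v) #|(X :\ v) :&: neighbors u| + #|X :&: neighbors v|.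
  rewrite -sum1_card [X in _ + X](eq_bigl (fun u => (u \in X :\ v) && adj v u)); last first.
    move=> u; rewrite !inE; case: eqP => [->|]; last by rewrite andbC.
    by rewrite adj_irrefl andbF.
  rewrite [X in _ + X]big_mkcondr -big_split /=; apply: eq_bigr => u uX.
  rewrite (cardsD1 v (X :&: _)) inE vX inE adj_sym addnC; congr (_ + _).
    by apply: eq_card => z; rewrite !inE andbA.
lia.
Qed.

Lemma path_alternate t X W : joined X W -> t <= #|X| -> t <= #|W| -> has_path t (X :|: W).
Proof.
move=> jXW tX tW; case: t => [|t] in tX tW *; first by exists [::].
have [x0 x0X] : exists x, x \in X by apply/card_gt0P; lia.
have iX k : k < t.+1 -> nth x0 (enum X) k \in X.
  by move=> kt; rewrite -mem_enum mem_nth // -cardE; lia.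
have iW k : k < t.+1 -> nth x0 (enum W) k \in W.
  by move=> kt; rewrite -mem_enum mem_nth // -cardE; lia.
pose f k := if odd k then nth x0 (enum X) k else nth x0 (enum W) k.
exists (mkseq f t.+1); split.
- by rewrite size_mkseq.
- apply/mkseq_uniqP => i j; rewrite !inE /f => it jt.
  case: ifP => oi; case: ifP => oj E.
  + by apply/eqP; rewrite -(nth_uniq x0 _ _ (enum_uniq X)) -?cardE ?E //; lia.
  + by have := jXW _ _ (iX i it) (iW j jt); rewrite E adj_irrefl.
  + by have := jXW _ _ (iX j jt) (iW i it); rewrite E adj_irrefl.
  + by apply/eqP; rewrite -(nth_uniq x0 _ _ (enum_uniq W)) -?cardE ?E //; lia.
- apply/(sortedP x0) => i; rewrite size_mkseq => it.
  rewrite !nth_mkseq //; last lia.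
  rewrite /f /=; case: (odd i) => /=; first by apply: jXW; [apply: iX|apply: iW]; lia.
  by rewrite adj_sym; apply: jXW; [apply: iX|apply: iW]; lia.
- move=> z /mapP[k]; rewrite mem_iota => kt ->; rewrite inE /f.
  by case: ifP => _; [rewrite iX|rewrite iW ?orbT]; lia.
Qed.

Lemma path_multipartite_bump t r i (A : nat -> {set G}) p : i < r ->
  size p = t -> uniq p -> sorted (@adj G) p ->
  (forall k, k < r -> k != i -> t <= #|A k| /\ joined [set x in p] (A k)) ->
  (forall k l, k < r -> l < r -> k != i -> l != i -> k != l -> joined (A k) (A l)) ->
  path_multipartite G t r.-1.
Proof.
move=> ir sp up ap hA jA; exists p, (fun k => A (bump i k)).
have br k : k < r.-1 -> (bump i k < r) && (bump i k != i).
  by move=> kr; rewrite eq_sym neq_bump andbT /bump; case: leqP; lia.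
split=> // [k /br/andP[b1 b2]|]; first exact: (hA _ b1 b2).1.
split=> [k l /br/andP[b1 b2] /br/andP[b3 b4] kl|k /br/andP[b1 b2]].
  by apply: jA => //; rewrite (can_eq (bumpK i)).
exact: (hA _ b1 b2).2.
Qed.

Lemma multipartite_path t r s U A : 0 < r -> t <= s -> multipartite r.+1 s A U ->
  path_multipartite G t r.-1.
Proof.
move=> r0 ts [sA jA].
have [|||p [sp up ap pX]] := @path_alternate t (A r) (A r.-1).
- by apply: jA; lia.
- by rewrite (sA r _).2.
- by rewrite (sA r.-1 _).2 //; lia.
apply: (@path_multipartite_bump t r r.-1 A p) => //; first lia.
  move=> k kr kr1; split; first by rewrite (sA k _).2 //; lia.
  move=> u v; rewrite inE => /pX; rewrite inE => /orP[] ur vk.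
    by apply: (jA r k) => //; lia.
  by apply: (jA r.-1 k) => //; lia.
by move=> k l kr lr _ _ kl; apply: jA => //; lia.
Qed.

End PathFree.

(** * Classification of the vertices by a large complete multipartite subgraph *)

Lemma card_bigcup_sum (T : finType) r (V : nat -> {set T}) :
  #|\bigcup_(i < r) V i| <= \sum_(i < r) #|V i|.
Proof.
elim: r => [|r IH]; first by rewrite !big_ord0 cards0.
rewrite !big_ord_recr /=; apply: leq_trans (leq_card_setU _ _) _.
by rewrite leq_add2r.
Qed.

Lemma bigcupP_nat (T : finType) r (V : nat -> {set T}) x :
  reflect (exists2 i, i < r & x \in V i) (x \in \bigcup_(i < r) V i).
Proof.
apply: (iffP bigcupP) => [[i _ xV]|[i ir xV]]; first by exists i.
by exists (Ordinal ir).
Qed.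

Section Classify.
Variable G : sgraph.
Implicit Types (A V : nat -> {set G}) (U W X : {set G}).

Definition others r V i : {set G} := \bigcup_(j < r | j != i :> nat) V j.

Lemma othersP r V i x :
  reflect (exists j, [/\ j < r, j != i & x \in V j]) (x \in others r V i).
Proof.
apply: (iffP bigcupP) => [[j ji xV]|[j [jr ji xV]]]; first by exists j.
by exists (Ordinal jr).
Qed.

Definition near_turan m r q n V U :=
  [/\ forall i, i < r -> V i \subset U /\ n <= m * #|V i|,
      forall i j, i < r -> j < r -> i != j -> [disjoint V i & V j],
      q * #|U :\: \bigcup_(i < r) V i| <= n,
      forall i v, i < r -> v \in V i -> q * #|V i :&: neighbors v| <= n &
      forall i v, i < r -> v \in V i -> q * #|others r V i :\: neighbors v| <= n].

Lemma common_neighbors X (p : {set G}) d : (forall v, v \in p -> #|X :\: neighbors v| <= d) ->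
  #|X| <= #|X :&: [set x | [forall v in p, adj v x]]| + #|p| * d.
Proof.
move=> pd; rewrite -(cardsID [set x | [forall v in p, adj v x]] X) leq_add2l.
apply: (@leq_trans #|\bigcup_(v in p) (X :\: neighbors v)|).
  apply: subset_leq_card; apply/subsetP => x; rewrite !inE => /andP[+ xA].
  case/forall_inPn => v vp nvx; apply/bigcupP; exists v => //; by rewrite !inE nvx.
rewrite -sum_nat_const.
apply: leq_trans (_ : \sum_(v in p) #|X :\: neighbors v| <= _); last exact: leq_sum.
elim/big_ind2: _ => [|a b c e ab ce|//]; first by rewrite cards0.
by apply: leq_trans (leq_card_setU _ _) (leq_add _ _).
Qed.

Lemma common_neighbors_joined X (p : {set G}) :
  joined p (X :&: [set x | [forall v in p, adj v x]]).
Proof. by move=> u v up; rewrite !inE => /andP[_ /forall_inP/(_ u up)]. Qed.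

Lemma classify t r s h q U A : 0 < t -> 0 < q -> 0 < r -> 4 * r <= q ->
  s = 8 * t * t * q -> h = 8 * t * r * q ->
  ~ path_multipartite G t r.-1 -> multipartite r s A U ->
  (forall v, v \in U -> r * h * #|U :\: neighbors v| <= (h + r) * #|U|) ->
  exists V W, [/\ W \subset U, #|W| <= t * 2 ^ (r * s) + r * s,
    (forall i, i < r -> V i \subset U /\ ~ has_path t (V i)) &
    (forall i j, i < r -> j < r -> i != j -> [disjoint V i & V j]) /\
    2 * q * #|U :\: \bigcup_(i < r) V i| <= #|U| + (4 * q * t + 2 * q) * #|W|].
Proof.
move=> t0 q0 r0 rq Es Eh npm mA deg.
have [AU jA] := mA.
have s2t : 2 * t <= s by rewrite Es; nia.
set k := #|U| in deg *.
pose W := [set w in U | [forall i : 'I_r, t <= #|A i :&: neighbors w|]].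
pose V i := [set w in U | (#|A i :&: neighbors w| < t) &&
  [forall j : 'I_r, (j != i :> nat) ==> (2 * t * #|A j :\: neighbors w| <= s)]].
have WU : W \subset U by apply/subsetP => w; rewrite inE => /andP[].
exists V, W; split=> //.
- rewrite leqNgt; apply/negP => cW; apply: npm.
  have [||A' mA'] := fiber_extend mA WU (s := t); last exact: multipartite_path mA'.
    by move=> w i; rewrite inE => /andP[_ /forallP h0] ir; apply: (h0 (Ordinal ir)).
  by lia.
- move=> i ir; split; first by apply/subsetP => w; rewrite inE => /andP[].
  move=> [p [sp up ap pV]]; apply: npm.
  pose P := [set x in p]; have cP : #|P| = t by rewrite cardsE (card_uniqP up).
  apply: (@path_multipartite_bump _ t r i (fun j => A j :&: [set x | [forall v in P, adj v x]]) p) => //.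
    move=> j jr ji; split; last exact: common_neighbors_joined.
    have [] := AU j jr => _ cA.
    have : forall v, v \in P -> #|A j :\: neighbors v| <= s %/ (2 * t).
      move=> v; rewrite inE => /pV; rewrite inE => /and3P[_ _ /forallP/(_ (Ordinal jr))/=].
      by rewrite ji /= => h0; rewrite leq_divRL; lia.
    move/common_neighbors; rewrite cA cP => h0.
    have h1 := leq_divM s (2 * t).
    by move: h0 h1; set X := #|_ :&: _|; nia.
  move=> j l jr lr ji li jl; apply: joinedS (jA j l jr lr jl); exact: subsetIl.
have cVs i w : i < r -> #|A i :&: neighbors w| < t -> s - t < #|A i :\: neighbors w|.
  by move=> ir lt; have := cardsID (neighbors w) (A i); rewrite (AU i ir).2; lia.
split.
  move=> i j ir jr ij; rewrite disjoint_subset; apply/subsetP => w.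
  rewrite !inE => /and3P[_ wi _]; apply/negP => /and3P[_ _ /forallP/(_ (Ordinal ir))/=].
  by rewrite ij /=; have := cVs i w ir wi; nia.
set B := U :\: _.
have low w : w \in U :\: W ->
    2 * t * (s - t) + s * (w \in B) <= \sum_(i < r) 2 * t * #|A i :\: neighbors w|.
  rewrite !inE => /andP[+ wU]; rewrite wU /= => /forallPn[i]; rewrite -ltnNge => lt.
  have c1 := cVs i w (ltn_ord i) lt.
  rewrite [leqRHS](bigD1 i) //= andbT; case: (boolP (w \in _)) => wV /=.
    rewrite muln0 addn0; apply: leq_trans _ (leq_addr _ _); rewrite leq_mul2l; apply/orP; right; lia.
  have : w \notin V i by apply: contra wV => wV; apply/bigcupP_nat; exists i.
  rewrite inE wU lt /= => /forallPn[j]; rewrite negb_imply -ltnNge => /andP[ji sj].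
  rewrite [X in _ <= _ + X](bigD1 j) //= muln1 addnA.
  apply: leq_trans _ (leq_addr _ _); apply: leq_add; last exact: ltnW.
  rewrite leq_mul2l; apply/orP; right; lia.
have H1 : \sum_(w in U :\: W) (2 * t * (s - t) + s * (w \in B)) <=
          \sum_(w in U) \sum_(i < r) 2 * t * #|A i :\: neighbors w|.
  apply: (@leq_trans (\sum_(w in U :\: W) \sum_(i < r) 2 * t * #|A i :\: neighbors w|)).
    exact: leq_sum.
  by rewrite [leqRHS](big_setID W) /= leq_addl.
have H2 : r * h * (\sum_(w in U) \sum_(i < r) 2 * t * #|A i :\: neighbors w|) <=
  r * (2 * t * s * ((h + r) * k)).
  rewrite exchange_big /= big_distrr /=.
  apply: (@leq_trans (\sum_(i < r) 2 * t * s * ((h + r) * k))); last first.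
    by rewrite sum_nat_const card_ord.
  apply: leq_sum => i _; rewrite -big_distrr /= card_nonadj mulnCA -[leqRHS]mulnA leq_mul2l; apply/orP; right.
  rewrite big_distrr /= -(AU i (ltn_ord i)).2 -sum_nat_const; apply: leq_sum => u.
  by move/(subsetP (AU i (ltn_ord i)).1)/deg.
move: H1; rewrite big_split /= sum_nat_const -big_distrr /= cardsDS // -/k => H1.
have cB : #|B| <= \sum_(w in U :\: W) (w \in B) + #|W|.
  rewrite -(cardsID W B) addnC; apply: leq_add; last by apply: subset_leq_card; apply: subsetIr.
  rewrite -sum1_card [leqRHS]big_mkcond [leqLHS]big_mkcond /=; apply: leq_sum => w _.
  by rewrite !inE; case: (w \in W); case: (w \in U); rewrite /= ?andbF //; case: (~~ _).
have H3 : h * (\sum_(w in U) \sum_(i < r) 2 * t * #|A i :\: neighbors w|) <=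
  2 * t * s * ((h + r) * k) by rewrite -(leq_pmul2l r0) mulnA.
move: cB H1 H3; set b := \sum_(w in _ :\: _) _; set S := \sum_(w in _) _; set c := #|W|; set Bc := #|B|.
have ck : c <= k by apply: subset_leq_card.
move=> cB H1 H3.
have H4 : h * ((k - c) * (2 * t * (s - t)) + s * b) <= 2 * t * s * ((h + r) * k).
  by apply: leq_trans H3; rewrite leq_mul2l H1 orbT.
suff : 2 * q * b <= k + 4 * q * t * c by have := leq_mul (leqnn (2 * q)) cB; lia.
have H5 : h * s * b <= 2 * t * s * r * k + 2 * t * t * h * k + 2 * t * h * s * c.
  have e1 : (k - c) * (2 * t * (s - t)) + 2 * t * t * k + 2 * t * s * c >= 2 * t * s * k.
    have [y Ey] : exists y, s = t + y by exists (s - t); lia.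
    have [z Ez] : exists z, k = c + z by exists (k - c); lia.
    by rewrite Ey Ez !addKn; nia.
  have := leq_mul (leqnn h) e1; move: H4; clear.
  set X := (k - c) * _; nia.
have h0 : 0 < h by rewrite Eh; nia.
have s0 : 0 < s by lia.
have hs0 : 0 < h * s by rewrite muln_gt0 h0.
rewrite -(leq_pmul2l hs0).
have e2 : 2 * q * (2 * t * s * r * k) * 2 = h * s * k by rewrite Eh; lia.
have e3 : 2 * q * (2 * t * t * h * k) * 2 = h * s * k by rewrite Es; lia.
by move: H5 e2 e3; clear; nia.
Qed.

End Classify.

Lemma path_free_high_degree (G : sgraph) t (X : {set G}) d k : ~ has_path t X ->
  k * #|[set v in X | k < d * #|X :&: neighbors v|]| <= d * (2 * t * #|X|).
Proof.
move=> /path_free_degree_sum sX; apply: leq_trans (leq_mul (leqnn d) sX).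
rewrite mulnC -sum_nat_const big_distrr /=.
rewrite [leqRHS](big_setID [set v in X | k < d * #|X :&: neighbors v|]) /=.
apply: leq_trans _ (leq_addr _ _); rewrite (setIidPr _); last first.
  by apply/subsetP => v; rewrite inE => /andP[].
by apply: leq_sum => v; rewrite inE => /andP[_ /ltnW].
Qed.

Lemma near_turan_of_degree t r q : 0 < t -> 2 <= r -> 2 * r <= q ->
  exists h n0, 0 < h /\ forall (G : sgraph) (U : {set G}), n0 <= #|U| ->
    ~ path_multipartite G t r.-1 ->
    (forall v, v \in U -> r * h * #|U :\: neighbors v| <= (h + r) * #|U|) ->
    exists V, near_turan (4 * r) r q #|U| V U.
Proof.
move=> t0 r2 rq; pose Q := 2 * q; pose s := 8 * t * t * Q; pose h := 8 * t * r * Q.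
have EQ : Q = 2 * q by []; have Es : s = 8 * t * t * Q by []; have Eh : h = 8 * t * r * Q by [].
have r0 : 0 < r by lia.
have q0 : 0 < q by lia.
have Q0 : 0 < Q by rewrite /Q; lia.
have h0 : 0 < h by rewrite !muln_gt0 t0 r0 q0.
have hr : 8 * r * Q <= h by rewrite /h; nia.
have hr2 : 32 * (r * r) <= h by apply: leq_trans hr; rewrite /Q; nia.
clearbody s h Q.
have rh0 : 0 < r * h by rewrite muln_gt0 r0.
have [n1 n1P] := erdos_stone r.-1 (2 * (r * r)) s.
pose c0 := t * 2 ^ (r * s) + r * s.
pose C := (4 * Q * t + 2 * Q) * c0 + 2 * Q * (r * (2 * h * t)).
pose n0 := n1 + r * C + 2 * r * h * t + r * (2 * h * t); exists h, (4 * n0 + 1); split=> // G U nU npm deg.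
set k := #|U| in nU deg *.
have [||A mA] := n1P G U; first by rewrite -/k; lia.
  move=> v /deg; rewrite -/k; set x := #|_| => dx.
  have [r' Er] : exists r', r = r'.+1 by exists r.-1; lia.
  have h2 : 2 * (r * r) <= h by lia.
  rewrite -(leq_pmul2l rh0).
  have e1 := leq_mul (leqnn (2 * (r * r) * r.-1)) dx.
  have e2 : 2 * (r * r) * r.-1 * (h + r) + r * h * r.-1 <= r * h * (2 * (r * r)).
    by move: h2; rewrite Er /=; clear; nia.
  have e3 := leq_mul e2 (leqnn k).
  by move: e1 e3; clear; rewrite mulnDr !mulnDl; lia.
rewrite prednK // in mA.
have rQ : 4 * r <= Q by lia.
have [V [W [WU cW VU [dV bV]]]] := classify t0 Q0 r0 rQ Es Eh npm mA deg.
rewrite -/c0 -/k in cW bV.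
pose V' i := [set v in V i | h * #|V i :&: neighbors v| <= k].
have V'V i : V' i \subset V i by apply/subsetP => v; rewrite inE => /andP[].
have cVk i : i < r -> #|V i| <= k by move=> ir; apply: subset_leq_card; apply: (VU i ir).1.
have k0 : 0 < k by lia.
have rem i : i < r -> #|V i :\: V' i| <= 2 * h * t.
  move=> ir; have := path_free_high_degree h k (VU i ir).2.
  have -> : [set v in V i | k < h * #|V i :&: neighbors v|] = V i :\: V' i.
    by apply/setP => v; rewrite !inE; case: (v \in V i); rewrite ?andbF //= andbT ltnNge.
  have := cVk i ir => c1 c2; rewrite -(leq_pmul2l k0); apply: leq_trans c2 _.
  by apply: leq_trans (leq_mul (leqnn h) (leq_mul (leqnn _) c1)) _; lia.
have cU' : 2 * Q * #|U :\: \bigcup_(i < r) V' i| <= k + C.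
  have : #|U :\: \bigcup_(i < r) V' i| <=
      #|U :\: \bigcup_(i < r) V i| + #|\bigcup_(i < r) (V i :\: V' i)|.
    apply: leq_trans (leq_card_setU _ _); apply: subset_leq_card; apply/subsetP => x.
    rewrite !inE => /andP[/bigcupP_nat nx ->]; rewrite andbT.
    case: (boolP (x \in \bigcup_(i < r) V i)) => //= /bigcupP_nat[i ir xV].
    apply/(@bigcupP_nat _ r (fun i => V i :\: V' i)); exists i => //; rewrite inE xV andbT.
    by apply/negP => xV'; apply: nx; exists i.
  move=> /leq_trans/(_ (leq_add (leqnn _) (card_bigcup_le rem))) c1.
  have c2 := leq_mul (leqnn (4 * Q * t + 2 * Q)) cW.
  have := leq_mul (leqnn (2 * Q)) c1; move: bV c2; rewrite /C; clear; lia.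
have upV i : i < r -> r * h * #|V i| <= (h + 2 * r) * k.
  move=> ir; case: (set_0Vmem (V' i)) => [V0|[v vV]].
    have := rem i ir; rewrite V0 setD0 => c1.
    apply: (@leq_trans (r * h * (2 * h * t))); first by rewrite leq_mul2l c1 orbT.
    have : r * (2 * h * t) <= k by lia.
    by move/(leq_mul (leqnn h)); lia.
  have vVi := subsetP (V'V i) v vV.
  have vU := subsetP (VU i ir).1 v vVi.
  have := cardsID (neighbors v) (V i).
  have c1 : #|V i :\: neighbors v| <= #|U :\: neighbors v|.
    by apply: subset_leq_card; apply: setSD; apply: (VU i ir).1.
  have c2 := leq_trans (leq_mul (leqnn (r * h)) c1) (deg v vU).
  move: vV; rewrite inE => /andP[_] /(leq_mul (leqnn r)) c3 c4.
  by move: c2 c3; rewrite -c4; clear; lia.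
have kle : k <= #|U :\: \bigcup_(i < r) V' i| + \sum_(i < r) #|V i|.
  rewrite /k -(cardsID (\bigcup_(i < r) V' i) U) addnC leq_add2l.
  apply: leq_trans (card_bigcup_sum r V); apply: subset_leq_card.
  apply/subsetP => x; rewrite inE => /andP[_ /bigcupP_nat[i ir xV]].
  by apply/bigcupP_nat; exists i => //; apply: (subsetP (V'V i)).
have loV i : i < r ->
   2 * Q * r * h * k <= r * h * (k + C) + 2 * Q * ((r - 1) * ((h + 2 * r) * k)) +
                       2 * Q * (r * h * #|V i|).
  move=> ir.
  have c1 : \sum_(j < r) #|V j| = #|V i| + \sum_(j < r | j != i :> nat) #|V j|.
    by rewrite (bigD1 (Ordinal ir)).
  have c2 : r * h * \sum_(j < r | j != i :> nat) #|V j| <= (r - 1) * ((h + 2 * r) * k).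
    rewrite big_distrr /=.
    apply: (@leq_trans (\sum_(j < r | j != i :> nat) (h + 2 * r) * k)).
      by apply: leq_sum => j _; apply: upV.
    rewrite sum_nat_const leq_mul2r; apply/orP; right.
    rewrite [X in _ <= X](_ : _ = #|predC1 (Ordinal ir)|); last by rewrite cardC1 card_ord subn1.
    by apply/eq_leq/eq_card => j; rewrite !inE.
  have := leq_mul (leqnn (2 * Q * r * h)) kle; rewrite c1.
  have := leq_mul (leqnn (r * h)) cU'; have := leq_mul (leqnn (2 * Q)) c2.
  by clear; lia.
have Cr : 4 * r * C <= k by lia.
have Ck : C <= k by apply: leq_trans Cr; rewrite -[leqLHS]mul1n leq_mul2r muln_gt0 r0 orbT.
have e4 : 4 * Q * (r * r) * 2 <= Q * h by move: hr2; clear; nia.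
have e5 : 4 * (r * h) <= Q * h by move: rQ; clear; nia.
have [r' Er] : exists r', r = r'.+1 by exists r.-1; lia.
(* [2 Q r h |V i| >= (2 Q h - r h - 4 Q r^2) k - r h C], written without subtraction. *)
have loV' i : i < r ->
    2 * Q * h * k <= r * h * (k + C) + 4 * Q * (r * r) * k + 2 * Q * (r * h * #|V i|).
  by move=> /loV; rewrite Er subn1 /=; clear; lia.
have lo i : i < r -> k <= 2 * r * #|V i| + r * C.
  move=> /loV' c1; have Qh0 : 0 < Q * h by rewrite muln_gt0 Q0.
  rewrite -(leq_pmul2l Qh0).
  have := leq_mul e4 (leqnn k); have := leq_mul e5 (leqnn k).
  have : h * r * C <= Q * h * r * C by rewrite -[leqLHS]mul1n -!mulnA leq_mul2r Q0 orbT.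
  by move: c1; clear; lia.
exists V'; split.
- move=> i ir; split; first exact: subset_trans (V'V i) (VU i ir).1.
  have := cardsID (V' i) (V i); rewrite (setIidPr (V'V i)).
  have := leq_mul (leqnn (4 * r)) (rem i ir); have := lo i ir; move: nU; rewrite /n0; clear; lia.
- move=> i j ir jr ij; apply: disjointWl (V'V i) _; apply: disjointWr (V'V j) _; exact: dV.
- by move: cU' Ck; rewrite EQ; clear; lia.
- move=> i v ir; rewrite inE => /andP[vV le]; apply: leq_trans le.
  apply: leq_mul; first by apply: leq_trans hr; rewrite EQ; move: r0; clear; nia.
  by apply: subset_leq_card; apply: setSI.
move=> i v ir vV'.
have := vV'; rewrite inE => /andP[vV dv].
have vU := subsetP (VU i ir).1 v vV.
have c1 : #|others r V' i :\: neighbors v| + #|V i :\: neighbors v| <= #|U :\: neighbors v|.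
  rewrite -cardsUI (_ : _ :&: _ = set0) ?cards0 ?addn0.
    rewrite -setDUl; apply: subset_leq_card; apply: setSD; rewrite subUset (VU i ir).1 andbT.
    apply/subsetP => x /othersP[j [jr ji xV]]; apply: (subsetP (VU j jr).1).
    exact: (subsetP (V'V j)).
  apply/setP => x; rewrite !inE; apply/negP => /andP[/andP[_ /othersP[j [jr ji xV]]] /andP[_ xVi]].
  have := dV j i jr ir ji; rewrite disjoint_subset => /subsetP/(_ x).
  by rewrite (subsetP (V'V j) x xV) inE xVi => /(_ isT).
have c2 := cardsID (neighbors v) (V i).
have c3 := leq_trans (leq_mul (leqnn (r * h)) c1) (deg v vU).
have c4 := leq_mul (leqnn r) dv.
move: c3 c4 (loV' i ir); rewrite -c2; clearbody k C.
set y := #|others r V' i :\: _|; set a := #|_ :&: _|; set b := #|_ :\: _|.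
move=> c3 c4 c5.
rewrite -(leq_pmul2l rh0) -(leq_pmul2l (isT : 0 < 4)).
have c6 := leq_mul (leqnn (2 * Q)) c3; have c7 := leq_mul (leqnn (2 * Q)) c4.
have c8 : 8 * Q * r * r * k <= r * h * k.
  by rewrite leq_mul2r; apply/orP; right; move: hr; clear; nia.
have c9 : r * h * C <= r * h * k by rewrite leq_mul2l Ck orbT.
have c10 : 4 * Q * r * k <= 4 * Q * r * r * k.
  by rewrite leq_mul2r; apply/orP; right; move: r0; clear; nia.
move: c5 c6 c7 c8 c9 c10; rewrite EQ; clear; lia.
Qed.

(** * Hubs *)

Section Hubs.
Variable G : sgraph.
Implicit Types (A C V : nat -> {set G}) (P U W X B : {set G}).

Lemma greedy_parts d t (ks : seq nat) C P : uniq ks ->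
  (forall v l, v \in P -> l \in ks -> #|C l :\: neighbors v| <= d) ->
  (forall k l v, k \in ks -> l \in ks -> k != l -> v \in C k ->
    #|C l :\: neighbors v| <= d) ->
  (forall l, l \in ks -> (#|P| + t * size ks) * d + t <= #|C l|) ->
  exists A, (forall l, l \in ks -> [/\ A l \subset C l, #|A l| = t & joined P (A l)]) /\
    (forall k l, k \in ks -> l \in ks -> k != l -> joined (A k) (A l)).
Proof.
elim: ks P => [|k ks IH] P; first by exists (fun=> set0).
move=> /andP[kks uks] Pd Cd Csz.
have kin : k \in k :: ks by rewrite mem_head.
have sub l : l \in ks -> l \in k :: ks by rewrite inE orbC => ->.
have tk : t <= #|C k :&: [set z | [forall v in P, adj v z]]|.
  have := common_neighbors (fun v vP => Pd v k vP kin).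
  have := Csz k kin; rewrite /= mulnDl; lia.
have [Ak AkS cAk] := exists_subset tk.
have AkC : Ak \subset C k by apply: subset_trans AkS (subsetIl _ _).
have PAk : joined P Ak by apply: joinedS (subxx P) AkS (@common_neighbors_joined _ _ _).
have [|||A [AP AA]] := IH (P :|: Ak) uks.
- move=> v l; rewrite inE => /orP[vP|vA] lks; first by apply: Pd => //; apply: sub.
  apply: (Cd k) => //; [exact: sub| |exact: (subsetP AkC)].
  by apply: contraNneq kks => ->.
- by move=> j l v jks lks; apply: Cd; apply: sub.
- move=> l /sub/Csz; apply: leq_trans; rewrite leq_add2r leq_mul2r; apply/orP; right.
  have := leq_of_leqif (leq_card_setU P Ak); rewrite cAk /= mulnS; lia.
exists (fun l => if l == k then Ak else A l); split.
  move=> l; rewrite inE; case: eqP => [-> _|_ /= /AP[AC cA jA]]; first by split.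
  by split=> //; apply: joinedS jA => //; apply: subsetUl.
have AkA l : l \in ks -> joined Ak (A l).
  by move=> /AP[_ _ jA]; apply: joinedS jA => //; apply: subsetUr.
move=> j l; rewrite !inE; case: eqP => [->|_] /=; case: eqP => [->|_] //=.
- by rewrite eqxx.
- by move=> _ lks _; apply: AkA.
- by move=> jks _ _; apply: joined_sym; apply: AkA.
- exact: AA.
Qed.

Lemma card_adj X W :
  \sum_(w in W) #|X :&: neighbors w| = \sum_(u in X) #|W :&: neighbors u|.
Proof.
have E X' w : #|X' :&: neighbors w| = \sum_(u in X') adj w u.
  rewrite -sum1_card (eq_bigl (fun u => (u \in X') && adj w u)); last first.
    by move=> u; rewrite !inE.
  by rewrite big_mkcondr; apply: eq_bigr => u _; case: adj.
rewrite (eq_bigr _ (fun w _ => E X w)) exchange_big /=.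
apply: eq_bigr => u _; rewrite E; apply: eq_bigr => w _.
by rewrite adj_sym.
Qed.

Lemma dense_trace D W B n : 0 < D -> 0 < #|B| -> #|W| <= n ->
  (forall w, w \in B -> n <= D * #|W :&: neighbors w|) ->
  exists B', [/\ B' \subset B, #|B| <= 2 * D * #|B'| &
    n <= 2 * D * 2 ^ #|B| * #|W :&: [set z | [forall v in B', adj v z]]|].
Proof.
move=> D0 B0 Wn dB.
pose H := [set v in W | #|B| <= 2 * D * #|B :&: neighbors v|].
have HW : H \subset W by apply/subsetP => v; rewrite inE => /andP[].
have nH : n <= 2 * D * #|H|.
  have h1 : n * #|B| <= D * \sum_(v in W) #|B :&: neighbors v|.
    by rewrite -card_adj big_distrr /= mulnC -sum_nat_const; apply: leq_sum.
  rewrite (big_setID H) /= (setIidPr HW) in h1.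
  have h2 : \sum_(v in H) #|B :&: neighbors v| <= #|H| * #|B|.
    rewrite -sum_nat_const; apply: leq_sum => v _.
    by apply: subset_leq_card; apply: subsetIl.
  have h3 : 2 * D * \sum_(v in W :\: H) #|B :&: neighbors v| <= n * #|B|.
    apply: (@leq_trans (#|W :\: H| * #|B|)).
      rewrite big_distrr /= -sum_nat_const; apply: leq_sum => v.
      by rewrite !inE => /andP[+ vW]; rewrite vW /= -ltnNge => /ltnW.
    by rewrite leq_mul2r (leq_trans _ Wn) ?orbT // subset_leq_card // subsetDl.
  have h4 := leq_mul (leqnn (2 * D)) h2; rewrite -(leq_pmul2r B0).
  by move: h1 h3 h4; clear; lia.
have [H0|Hpos] := posnP #|H|.
  by exists B; rewrite subxx; split=> //; move: nH; rewrite H0 ?muln0; nia.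
have trB v : v \in H -> B :&: neighbors v \in powerset B by rewrite powersetE subsetIl.
have cH : (#|H|.-1 %/ 2 ^ #|B|) * #|powerset B| < #|H|.
  by rewrite card_powerset; have := leq_divM #|H|.-1 (2 ^ #|B|); lia.
have [B' _ cB'] := pigeonhole trB cH.
have [v0 v0H] : exists v, v \in [set w in H | B :&: neighbors w == B'].
  by apply/card_gt0P; apply: leq_ltn_trans (leq0n _) cB'.
move: v0H; rewrite inE => /andP[]; rewrite inE => /andP[_ c0] /eqP E0.
exists B'; split; first by rewrite -E0 subsetIl.
  by rewrite -E0.
have c1 : #|[set w in H | B :&: neighbors w == B']| <=
   #|W :&: [set z | [forall v in B', adj v z]]|.
  apply: subset_leq_card; apply/subsetP => w; rewrite !inE => /andP[/andP[-> _] /eqP <-] /=.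
  by apply/forall_inP => v; rewrite !inE adj_sym => /andP[].
have := leq_trans cB' c1; set c := #|_ :&: _| => {}c1.
apply: leq_trans nH _; rewrite -[leqRHS]mulnA leq_mul2l; apply/orP; right.
move: c1; rewrite ltn_divLR ?expn_gt0 //; rewrite mulnC; lia.
Qed.

(* [K_(r+1)(t)] is found by shrinking the set of hubs [r] times with [dense_trace]. *)
Lemma few_hubs r t D n V B d : 0 < r -> 0 < t -> 0 < D -> #|G| <= n ->
  ~ path_multipartite G t r.-1 ->
  let b := t * (2 * D) ^ r in
  (forall k l v, k < r -> l < r -> k != l -> v \in V k -> #|V l :\: neighbors v| <= d) ->
  (forall w i, w \in B -> i < r -> n <= D * #|V i :&: neighbors w|) ->
  2 * D * 2 ^ b * ((t + t * r) * d + t) < n ->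
  #|B| < b.
Proof.
move=> r0 t0 D0 Gn npm b dV hB nbig; rewrite ltnNge; apply/negP => bB; apply: npm.
have [B0 B0B cB0] := exists_subset bB.
have step j : j <= r -> exists B1, [/\ B1 \subset B0, t * (2 * D) ^ (r - j) <= #|B1| &
    forall i, i < j ->
      n <= 2 * D * 2 ^ b * #|V i :&: [set z | [forall v in B1, adj v z]]|].
  elim: j => [_|j IH jr]; first by exists B0; rewrite subn0 cB0.
  have [B1 [B1B0 cB1 nB1]] := IH (ltnW jr).
  have B1pos : 0 < #|B1|.
    by apply: leq_trans cB1; rewrite muln_gt0 t0 expn_gt0 muln_gt0 D0.
  have Vn : #|V j| <= n by apply: leq_trans (max_card _) Gn.
  have [|B2 [B21 cB2 nB2]] := @dense_trace D (V j) B1 n D0 B1pos Vn.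
    by move=> w /(subsetP B1B0)/(subsetP B0B) wB; apply: hB.
  exists B2; split; first exact: subset_trans B21 B1B0.
    rewrite -(@leq_pmul2l (2 * D)) ?muln_gt0 ?D0 //; apply: leq_trans cB2.
    by apply: leq_trans cB1; rewrite -[r - j]prednK ?subn_gt0 // expnS -subnS; lia.
  move=> i; rewrite ltnS leq_eqVlt => /orP[/eqP->|ij].
    apply: leq_trans nB2 _; rewrite leq_mul2r; apply/orP; right.
    rewrite leq_mul2l leq_exp2l //; apply/orP; right; rewrite -cB0.
    exact: subset_leq_card.
  apply: leq_trans (nB1 i ij) _; rewrite leq_mul2l; apply/orP; right.
  apply: subset_leq_card; apply: setIS; apply/subsetP => z; rewrite !inE.
  by move/forall_inP => h0; apply/forall_inP => v /(subsetP B21)/h0.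
have [B1 [_ cB1 nB1]] := step r (leqnn r).
rewrite subnn expn0 muln1 in cB1.
have [P PB1 cP] := exists_subset cB1.
pose C i := V i :&: [set z | [forall v in B1, adj v z]].
have [|||A [AP AA]] := @greedy_parts d t (iota 0 r) C P (iota_uniq _ _).
- move=> v l vP; rewrite mem_iota => lr; rewrite (_ : _ :\: _ = set0) ?cards0 //.
  apply/setP => z; rewrite !inE; apply/negP => /and3P[nvz _ /forall_inP/(_ v (subsetP PB1 v vP))].
  by rewrite (negPf nvz).
- move=> k l v; rewrite !mem_iota !add0n => kr lr kl; rewrite inE => /andP[vV _].
  by apply: leq_trans (dV k l v kr lr kl vV); apply: subset_leq_card; apply: setSD; apply: subsetIl.
- move=> l; rewrite mem_iota add0n size_iota cP => lr.
  have := leq_trans nbig (nB1 l lr); rewrite ltn_pmul2l ?muln_gt0 ?D0 ?expn_gt0 //.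
  by move/ltnW.
apply: (@multipartite_path G t r t [set: G] (fun i => if i == r then P else A i)) => //.
have rA i : i < r.+1 -> i != r -> i \in iota 0 r by rewrite mem_iota; lia.
split=> [i ir|i k ir kr ik].
  rewrite subsetT; split=> //.
  by case: eqP => // /eqP ni; have [] := AP i (rA i ir ni).
case: eqP => [Ei|/eqP ni]; case: eqP => [Ek|/eqP nk].
- by rewrite Ei Ek eqxx in ik.
- by have [] := AP k (rA k kr nk).
- by apply: joined_sym; have [] := AP i (rA i ir ni).
- by apply: AA => //; apply: rA.
Qed.

End Hubs.

(** * Sunflowers and traces *)

(* [M0] is the core of a weak sunflower: a point outside [M0] lies in few of the sets
   [miss v], [v \in A'], so that some of them avoids any [t] given points. *)
Lemma popular_core (T : finType) (A : {set T}) (miss : T -> {set T}) m t :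
  (forall v, v \in A -> #|miss v| <= m) -> (2 * t + 2) ^ m.+1 <= #|A| ->
  exists M0 A' : {set T}, [/\ A' \subset A, forall v, v \in A' -> M0 \subset miss v &
    forall Q : {set T}, #|Q| <= t -> exists u, [/\ u \in A', u \notin Q &
      forall w, w \in Q -> w \notin M0 -> w \notin miss u]].
Proof.
set L := 2 * t + 2 => missm LA.
pose cl (M : {set T}) := [set v in A | M \subset miss v].
pose P (M : {set T}) := (#|M| <= m) && (L ^ (m.+1 - #|M|) <= #|cl M|).
have P0 : P set0.
  rewrite /P cards0 subn0; apply: leq_trans LA _; apply: subset_leq_card.
  by apply/subsetP => v vA; rewrite inE vA sub0set.
case: (@arg_maxnP _ set0 P (fun M => #|M|) P0) => M0 /andP[M0m LM0] M0max.
have Lpos : 0 < L by rewrite /L addn2.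
exists M0, (cl M0); split.
- by apply/subsetP => v; rewrite inE => /andP[].
- by move=> v; rewrite inE => /andP[].
move=> Q Qt; pose K := L ^ (m - #|M0|).
have K0 : 0 < K by rewrite expn_gt0 Lpos.
have clK : L * K <= #|cl M0| by rewrite -expnS -subSn.
have few w : w \notin M0 -> #|cl (w |: M0)| <= K.
  move=> wM; have cw : #|w |: M0| = #|M0|.+1 by rewrite cardsU1 wM.
  have [lt|ge] := ltnP #|M0| m; last first.
    rewrite (_ : cl _ = set0) ?cards0 //; apply/setP => v; rewrite !inE.
    apply/negP => /andP[vA /subset_leq_card]; rewrite cw => h.
    by have := leq_trans h (missm v vA); lia.
  rewrite leqNgt; apply/negP => big.
  have := M0max (w |: M0); rewrite /P cw lt subSS => /(_ (ltnW big)); lia.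
pose Bad := Q :|: \bigcup_(w in Q :\: M0) cl (w |: M0).
have cBad : #|Bad| < #|cl M0|.
  apply: leq_ltn_trans (leq_card_setU _ _) _.
  have : #|\bigcup_(w in Q :\: M0) cl (w |: M0)| <= \sum_(w in Q :\: M0) K.
    apply: (@leq_trans (\sum_(w in Q :\: M0) #|cl (w |: M0)|)).
      elim/big_ind2: _ => [|a b c e ab ce|//]; first by rewrite cards0.
      by apply: leq_trans (leq_card_setU _ _) (leq_add _ _).
    by apply: leq_sum => w; rewrite inE => /andP[wM _]; apply: few.
  rewrite sum_nat_const => h.
  have h1 : #|Q :\: M0| <= t by apply: leq_trans Qt; apply: subset_leq_card; apply: subsetDl.
  have h2 := leq_mul h1 (leqnn K).
  by move: clK h h2 Qt K0; rewrite /L; clear; nia.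
have /subsetPn[u ucl ubad] : ~~ (cl M0 \subset Bad).
  by apply: contraL cBad => /subset_leq_card; rewrite leqNgt.
move: ubad; rewrite inE negb_or => /andP[uQ ubad].
exists u; split=> // w wQ wM; apply: contra ubad => wu.
apply/bigcupP; exists w; first by rewrite inE wM wQ.
move: ucl; rewrite !inE => /andP[-> M0u].
by rewrite subUset sub1set wu.
Qed.

Section Traces.
Variable G : sgraph.
Implicit Types (H X Y R B : {set G}).

Lemma long_path t X (p : seq G) : uniq p -> sorted (@adj G) p -> {subset p <= X} ->
  t <= size p -> has_path t X.
Proof.
move=> up sp pX tp; exists (take t p); split.
- by rewrite size_takel.
- exact: take_uniq.
- exact: take_sorted.
- by move=> z /mem_take/pX.
Qed.

(* After a set [R] of vertices with few neighbours has been pruned, every vertex of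
   [H] has so many neighbours in the rest of [Y] that a path through [H] can always
   be prolonged. *)
Lemma few_traces t X H Y K : ~ has_path t X -> H \subset X -> Y \subset X ->
  (forall y, y \in Y -> H :&: neighbors y != set0) ->
  (forall tr : {set G}, #|[set y in Y | H :&: neighbors y == tr]| <= K) ->
  #|Y| <= (2 ^ t * K + t) * #|H|.
Proof.
move=> nX HX YX Yne Ytr; rewrite leqNgt; apply/negP => big; apply: nX.
set L := _ + _ in big.
pose NY R := [set y in Y | R :&: neighbors y != set0].
pose P R := (R \subset H) && (#|NY R| <= L * #|R|).
have P0 : P set0.
  rewrite /P sub0set (_ : NY _ = set0) ?cards0 //.
  by apply/setP => y; rewrite !inE set0I eqxx andbF.
case: (@arg_maxnP _ set0 P (fun R => #|R|) P0) => R /andP[RH cR] Rmax.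
pose Y2 := [set y in Y | R :&: neighbors y == set0].
have Y2ne : Y2 != set0.
  apply/negP => /eqP Y20; have : Y \subset NY R.
    apply/subsetP => y yY; rewrite inE yY; apply/negP => h.
    by have : y \in Y2; [rewrite inE yY|rewrite Y20 inE].
  move/subset_leq_card => h; have := leq_mul (leqnn L) (subset_leq_card RH); lia.
have rich a : a \in H -> a \notin R -> L < #|Y2 :&: neighbors a|.
  move=> aH aR; rewrite ltnNge; apply/negP => small.
  have := Rmax (a |: R); rewrite /P subUset sub1set aH RH /= cardsU1 aR.
  have : #|NY (a |: R)| <= #|NY R| + #|Y2 :&: neighbors a|.
    apply: leq_trans (leq_card_setU _ _); apply: subset_leq_card; apply/subsetP => y.
    rewrite !inE => /andP[yY]; rewrite yY /= => /set0Pn[z]; rewrite !inE => /andP[zaR yz].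
    case: eqP => //= Ry; case/orP: zaR => [/eqP <-|zR]; first by rewrite adj_sym.
    by have : z \in R :&: neighbors y; [rewrite !inE zR|rewrite Ry inE].
  by move=> h1 h2; have : #|R| < #|R|; [apply: h2; rewrite mulnDr muln1; lia|rewrite ltnn].
have start : exists a, a \in H /\ a \notin R.
  have [y yY2] := set0Pn _ Y2ne; move: yY2; rewrite inE => /andP[yY /eqP Ry].
  have [a] := set0Pn _ (Yne y yY); rewrite inE => /andP[aH ya]; exists a; split=> //.
  by apply/negP => aR; have : a \in R :&: neighbors y; [rewrite inE aR|rewrite Ry inE].
have step m : m <= t -> exists a p, [/\ a \in H, a \notin R,
    uniq (a :: p) & path (@adj G) a p /\ {subset a :: p <= X} /\ m <= size (a :: p)].
  elim: m => [_|m IH mt].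
    have [a [aH aR]] := start; exists a, [::]; split=> //; split=> //; split=> // z.
    by rewrite inE => /eqP->; apply: (subsetP HX).
  have [a [p [aH aR up [ap [pX mp]]]]] := IH (ltnW mt).
  have [big'|small] := ltnP m (size (a :: p)); first by exists a, p.
  pose S := [set z in a :: p].
  have cS : #|S| <= t by rewrite cardsE (leq_trans (card_size _)) // (leq_trans small) // ltnW.
  pose Y3 := [set y in Y | H :&: neighbors y \subset S].
  have cY3 : #|Y3| <= 2 ^ t * K.
    apply: (@leq_trans (#|powerset S| * K)); last first.
      by rewrite card_powerset leq_mul2r leq_exp2l // cS orbT.
    rewrite -sum_nat_const -sum1_card.
    rewrite (partition_big (fun y => H :&: neighbors y) [in powerset S]) /=; last first.
      by move=> y; rewrite !inE => /andP[].
    apply: leq_sum => tr _; rewrite sum1_card; apply: leq_trans (Ytr tr).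
    apply: subset_leq_card; apply/subsetP => y; rewrite unfold_in !inE.
    by move=> /andP[/andP[-> _] ->].
  have /subsetPn[y] : ~~ (Y2 :&: neighbors a \subset Y3 :|: S).
    apply/negP => /subset_leq_card; have := leq_of_leqif (leq_card_setU Y3 S).
    by have := rich a aH aR; rewrite /L; lia.
  rewrite !inE negb_or => /andP[/andP[yY /eqP yR] ay]; rewrite yY /= => /andP[].
  move=> /subsetPn[a']; rewrite !inE => /andP[a'H ya'] a'p; rewrite -/(y \in a :: p) => yp.
  have a'R : a' \notin R.
    by apply/negP => aR'; have : a' \in R :&: neighbors y; [rewrite !inE aR'|rewrite yR inE].
  have yp' : y \notin a :: p by rewrite inE.
  have a'y : a' \notin [:: y, a & p].
    rewrite in_cons negb_or in_cons a'p andbT; apply: contraTneq ya' => ->.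
    by rewrite adj_irrefl.
  exists a', [:: y, a & p]; split=> //; first by apply/and3P; split.
  split; first by rewrite /= adj_sym ya' adj_sym ay.
  split; last by rewrite ltnS; apply: leq_trans mp (leqnSn _).
  move=> z; rewrite in_cons => /orP[/eqP->|]; first exact: (subsetP HX).
  by rewrite in_cons => /orP[/eqP->|/pX//]; apply: (subsetP YX).
have [a [p [_ _ up [ap [pX tp]]]]] := step t (leqnn t).
by apply: (@long_path t X (a :: p)).
Qed.

Lemma matching_or_cover X m :
  (exists2 M, matching X M & size M = m) \/
  (exists K : {set G}, [/\ K \subset X, #|K| <= 2 * m &
     forall u v, u \in X :\: K -> v \in X :\: K -> ~~ adj u v]).
Proof.
elim: m => [|m [[M [uM MX aM] sM]|[K [KX cK nK]]]].
- by left; exists [::].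
- pose K := [set z in unzip1 M ++ unzip2 M].
  have cK : #|K| <= 2 * m.
    by rewrite cardsE (leq_trans (card_size _)) // size_cat !size_map sM; lia.
  case: (boolP [exists u in X :\: K, [exists v in X :\: K, adj u v]]) => [|none].
    case/exists_inP => u; rewrite !inE => /andP[uK uX].
    case/exists_inP => v; rewrite !inE => /andP[vK vX] uv.
    left; exists ((u, v) :: M); last by rewrite /= sM.
    split.
    + rewrite /= mem_cat in_cons.
      have -> : uniq (unzip1 M ++ v :: unzip2 M) by rewrite -cat1s uniq_catCA cat1s cons_uniq uM vK.
      rewrite andbT; apply/negP => /or3P[uin|/eqP uv'|uin].
      * by rewrite mem_cat uin in uK.
      * by rewrite uv' adj_irrefl in uv.
      * by rewrite mem_cat uin orbT in uK.
    + move=> z; rewrite /= in_cons mem_cat in_cons => /or4P[/eqP->|zM|/eqP->|zM] //; apply: MX.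
        by rewrite mem_cat zM.
      by rewrite mem_cat zM orbT.
    + by move=> e; rewrite in_cons => /orP[/eqP->|/aM].
  right; exists K; split.
  + by apply/subsetP => z; rewrite inE => /MX.
  + by rewrite (leq_trans cK) //; lia.
  + move=> u v uK vK; apply: contra none => uv.
    by apply/exists_inP; exists u => //; apply/exists_inP; exists v.
by right; exists K; split=> //; rewrite (leq_trans cK) //; lia.
Qed.

End Traces.

From mathcomp Require Import reals.
Import Order.TTheory GRing.Theory Num.Theory.

(** * Perron vectors *)

Section Perron.
Import classical_sets filter boolp topology function_spaces normedtype derive.
Import numFieldNormedType.Exports.
Local Open Scope ring_scope.
Variables (R : realType) (T : finType).
Implicit Types (e : rel T) (x y : T -> R).

Definition quad e y : R := \sum_u \sum_v (e u v)%:R * y u * y v.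

Definition sqnorm y : R := \sum_u y u ^+ 2.

Definition adjsum e y u : R := \sum_v (e u v)%:R * y v.

Lemma quadE e y : quad e y = \sum_u y u * adjsum e y u.
Proof.
apply: eq_bigr => u _; rewrite /adjsum mulr_sumr.
by apply: eq_bigr => v _; rewrite mulrA [y u * _]mulrC.
Qed.

Lemma sqnorm_ge0 y : 0 <= sqnorm y.
Proof. by apply: sumr_ge0 => u _; apply: sqr_ge0. Qed.

Lemma sqnorm_eq0 y : sqnorm y = 0 -> forall u, y u = 0.
Proof.
move=> y0 u; apply/eqP; rewrite -sqrf_eq0.
have/eqP := y0; rewrite /sqnorm psumr_eq0 => [/allP/(_ u)|w _]; last exact: sqr_ge0.
by rewrite mem_index_enum => /(_ isT).
Qed.

Lemma quadZ e a y : quad e (fun u => a * y u) = a ^+ 2 * quad e y.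
Proof.
rewrite /quad mulr_sumr; apply: eq_bigr => u _; rewrite mulr_sumr.
by apply: eq_bigr => v _; ring.
Qed.

Lemma sqnormZ a y : sqnorm (fun u => a * y u) = a ^+ 2 * sqnorm y.
Proof. by rewrite /sqnorm mulr_sumr; apply: eq_bigr => u _; rewrite exprMn. Qed.

Lemma sum_continuous (X : topologicalType) (s : seq T) (f : T -> X -> R) :
  (forall i, continuous (f i)) -> continuous (fun z => \sum_(i <- s) f i z).
Proof.
move=> cf; apply: (@continuous_big R) => [|i _]; last exact: cf.
exact: (@tvs.add_continuous R).
Qed.

Lemma mul_continuous (X : topologicalType) (f g : X -> R) :
  continuous f -> continuous g -> continuous (fun z => f z * g z).
Proof. by move=> cf cg z; apply: (@continuousM R); [exact: cf|exact: cg]. Qed.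

Lemma quad_max e : (0 < #|T|)%N ->
  exists2 x, sqnorm x = 1 & forall y, quad e y <= quad e x * sqnorm y.
Proof.
move=> T0.
pose F (M : ('rV[R]_#|T|)) : T -> R := fun u => M ord0 (enum_rank u).
have cF u : continuous (fun M => F M u) by move=> M; apply: coord_continuous.
have cq : continuous (fun M => quad e (F M)).
  apply: sum_continuous => u; apply: sum_continuous => v.
  by do 2?apply: mul_continuous; [exact: cst_continuous|exact: cF..].
have cn : continuous (fun M => sqnorm (F M)).
  by apply: sum_continuous => u; apply: mul_continuous; exact: cF.
pose A := [set M | sqnorm (F M) = 1]%classic.
have AF y : sqnorm y = 1 -> exists2 M, A M & F M = y.
  move=> y1; have E : F (\row_j y (enum_val j)) = y.
    by apply: funext => u; rewrite /F mxE enum_rankK.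
  by exists (\row_j y (enum_val j)); rewrite /A //= E.
have [u0 _] : exists u, u \in T by apply/card_gt0P.
have A0 : (A !=set0)%classic.
  have [M AM _] : exists2 M, A M & F M = (fun u => (u == u0)%:R).
    apply: AF; rewrite /sqnorm (bigD1 u0) //= eqxx expr1n big1 ?addr0 // => u.
    by move=> /negPf->; rewrite expr0n.
  by exists M.
have cA : compact A.
  apply: bounded_closed_compact.
    exists 1; split; first exact: real1.
    move=> b b1 M /= AM; rewrite /Num.norm /= mx_normrE; apply/bigmax_leP; split.
      by apply: le_trans (ltW b1).
    move=> [i j] _ /=; rewrite (ord1 i); apply: le_trans (ltW b1).
    rewrite -(@expr_le1 _ 2) ?normr_ge0 // real_normK ?num_real // -AM /sqnorm (bigD1 (enum_val j)) //= /F enum_valK.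
    by rewrite lerDl; apply: sumr_ge0 => u _; apply: sqr_ge0.
  have -> : A = ((fun M => sqnorm (F M)) @^-1` [set 1])%classic by [].
  by apply: preimage_closed => [M _|]; [exact: cn|exact: closed_eq].
have cqA : {within A, continuous (fun M => quad e (F M))}%classic.
  exact: continuous_subspaceT.
have [M AM maxM] := EVT_max_rV A0 cA cqA.
exists (F M); first by move: AM; rewrite inE.
move=> y; have [y0|yN0] := eqVneq (sqnorm y) 0.
  rewrite y0 mulr0 /quad big1 // => u _; rewrite big1 // => v _.
  by rewrite (sqnorm_eq0 y0) mulr0 mul0r.
have y_gt0 : 0 < sqnorm y by rewrite lt_def yN0 sqnorm_ge0.
set s := Num.sqrt (sqnorm y).
have s0 : 0 < s by rewrite sqrtr_gt0.
have s2 : s ^+ 2 = sqnorm y by rewrite sqr_sqrtr ?sqnorm_ge0.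
have [|N AN FN] := AF (fun u => s^-1 * y u).
  by rewrite sqnormZ exprVn s2 mulVf.
have := maxM N; rewrite FN quadZ inE => /(_ AN).
by rewrite exprVn s2 mulrC ler_pdivrMr.
Qed.

Lemma quad_shift e x w s : symmetric e -> irreflexive e ->
  quad e (fun u => x u + s * (u == w)%:R) =
  quad e x + 2 * s * adjsum e x w.
Proof.
move=> es ei.
have E1 : \sum_u \sum_v (e u v)%:R * x u * (v == w)%:R = adjsum e x w.
  rewrite /adjsum; apply: eq_bigr => u _; rewrite (bigD1 w) //= eqxx mulr1 big1 ?addr0.
    by rewrite es.
  by move=> v /negPf->; rewrite mulr0.
have E2 : \sum_u \sum_v (e u v)%:R * (u == w)%:R * x v = adjsum e x w.
  rewrite /adjsum (bigD1 w) //= [X in _ + X]big1 ?addr0.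
    by apply: eq_bigr => v _; rewrite eqxx mulr1.
  by move=> u /negPf->; rewrite big1 // => v _; rewrite mulr0 mul0r.
have E3 : \sum_u \sum_v (e u v)%:R * (u == w)%:R * (v == w)%:R = 0 :> R.
  apply: big1 => u _; apply: big1 => v _.
  by case: eqP => [->|]; case: eqP => [->|]; rewrite ?ei !(mulr0, mul0r).
have -> : 2 * s * adjsum e x w = s * adjsum e x w + s * adjsum e x w by ring.
have {}E3 : s ^+ 2 * (\sum_u \sum_v (e u v)%:R * (u == w)%:R * (v == w)%:R) = 0.
  by rewrite E3 mulr0.
rewrite -{1}E1 -E2 -[LHS]subr0 -[X in _ - X = _]E3 /quad.
rewrite !mulr_sumr -!big_split -sumrB /=; apply: eq_bigr => u _.
rewrite !mulr_sumr -!big_split -sumrB /=; apply: eq_bigr => v _; ring.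
Qed.

Lemma sqnorm_shift x w s :
  sqnorm (fun u => x u + s * (u == w)%:R) = sqnorm x + 2 * s * x w + s ^+ 2.
Proof.
rewrite /sqnorm (bigD1 w) //= [in RHS](bigD1 w) //= eqxx mulr1.
rewrite [X in _ + X = _](eq_bigr (fun u => x u ^+ 2)); first by ring.
by move=> u /negPf->; rewrite mulr0 addr0.
Qed.

(* Shifting [x] by [s] in coordinate [w] with the optimal [s]. *)
Lemma rayleigh_defect e x rho w : symmetric e -> irreflexive e -> 0 < rho ->
  (forall y, quad e y <= rho * sqnorm y) ->
  quad e x + (adjsum e x w - rho * x w) ^+ 2 / rho <= rho * sqnorm x.
Proof.
move=> es ei rho0 /(_ (fun u => x u + (adjsum e x w - rho * x w) / rho * (u == w)%:R)).
rewrite quad_shift // sqnorm_shift; set d := adjsum e x w - _.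
have -> : adjsum e x w = d + rho * x w by rewrite subrK.
move=> H; rewrite -subr_ge0; move: H; rewrite -subr_ge0; congr (_ <= _).
by field; rewrite gt_eqF.
Qed.

Lemma rayleigh_eigen e x rho : symmetric e -> irreflexive e -> 0 < rho ->
  (forall y, quad e y <= rho * sqnorm y) -> rho * sqnorm x <= quad e x ->
  forall w, adjsum e x w = rho * x w.
Proof.
move=> es ei rho0 H qx w; apply/eqP; rewrite -subr_eq0 -sqrf_eq0.
have := rayleigh_defect x w es ei rho0 H.
rewrite -lerBrDl => /le_trans/(_ (_ : _ <= 0)).
rewrite subr_le0 qx => /(_ isT).
rewrite pmulr_lle0 ?invr_gt0 // => h.
by rewrite eq_le h sqr_ge0.
Qed.

Lemma quad0 e : quad e (fun=> 0) = 0.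
Proof. by rewrite /quad big1 // => u _; rewrite big1 // => v _; rewrite mulr0. Qed.

Lemma adjsum0 e u : adjsum e (fun=> 0) u = 0.
Proof. by rewrite /adjsum big1 // => v _; rewrite mulr0. Qed.

Lemma sqnorm0 : sqnorm (fun=> 0) = 0.
Proof. by rewrite /sqnorm big1 // => u _; rewrite expr0n. Qed.

Lemma perron e : symmetric e -> irreflexive e -> (0 < #|T|)%N ->
  exists (rho : R) (x : T -> R),
    [/\ 0 <= rho, forall u, 0 <= x u, sqnorm x = 1,
        forall u, adjsum e x u = rho * x u &
        forall y, quad e y <= rho * sqnorm y].
Proof.
move=> es ei T0; have [x x1 xmax] := quad_max e T0.
have qge0 : 0 <= quad e x.
  have [u0 _] : exists u, u \in T by apply/card_gt0P.
  have := xmax (fun u => 0 + 1 * (u == u0)%:R).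
  rewrite quad_shift // sqnorm_shift quad0 adjsum0 sqnorm0.
  by rewrite !(addr0, add0r, mulr0, mulr1) expr1n mulr1.
have x'1 : sqnorm (fun u => `|x u|) = 1.
  by rewrite -x1; apply: eq_bigr => u _; rewrite real_normK ?num_real.
have qx' : quad e x <= quad e (fun u => `|x u|).
  apply: ler_sum => u _; apply: ler_sum => v _; rewrite -!mulrA.
  by apply: ler_wpM2l => //; rewrite -normrM ler_norm.
exists (quad e x), (fun u => `|x u|); split=> // u.
have [q0|qN0] := eqVneq (quad e x) 0; last first.
  apply: rayleigh_eigen => //; first by rewrite lt_def qN0.
  by rewrite x'1 mulr1.
rewrite q0 mul0r /adjsum big1 // => v _.
have [euv|//] := boolP (e u v); last by rewrite mul0r.
have := xmax (fun z => (0 + 1 * (z == u)%:R) + 1 * (z == v)%:R).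
rewrite q0 mul0r quad_shift // quad_shift // /adjsum.
have -> : \sum_w (e v w)%:R * (0 + 1 * (w == u)%:R) = 1 :> R.
  rewrite (bigD1 u) //= eqxx es euv big1 ?addr0 ?add0r ?mulr1 // => w /negPf->.
  by rewrite !(mulr0, addr0).
rewrite -/(adjsum e _ u) adjsum0 quad0; lra.
Qed.

End Perron.

(** * Subgraphs of large minimum degree *)

Section Spectral.
Import classical_sets filter boolp.
Local Open Scope ring_scope.
Variables (R : realType).

Lemma sup_max (A : set R) m : A m -> (forall a, A a -> a <= m) -> sup A = m.
Proof.
move=> Am mA; apply/eqP; rewrite eq_le; apply/andP; split.
  by apply: ge_sup => //; exists m.
by apply: ub_le_sup => //; exists m.
Qed.

Lemma sqr_sum_le (T : finType) (A : {set T}) (f : T -> R) :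
  (\sum_(i in A) f i) ^+ 2 <= #|A|%:R * \sum_(i in A) f i ^+ 2.
Proof.
set S := \sum_(i in A) f i; set n : R := #|A|%:R.
have [A0|A0] := eqVneq #|A| 0%N.
  by rewrite /S (cards0_eq A0) !big_set0 expr0n mulr0.
have n0 : 0 < n by rewrite ltr0n lt0n.
have : 0 <= \sum_(i in A) (n * f i - S) ^+ 2 by apply: sumr_ge0 => i _; apply: sqr_ge0.
rewrite (eq_bigr (fun i => n ^+ 2 * f i ^+ 2 - (2 * n * S) * f i + S ^+ 2)); last first.
  by move=> i _; ring.
rewrite big_split sumrB /= -!mulr_sumr -/S sumr_const -mulr_natr -/n => H.
rewrite -subr_ge0 -(pmulr_rge0 _ n0); apply: le_trans H _.
by rewrite le_eqVlt; apply/orP; left; apply/eqP; ring.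
Qed.

Definition top_rayleigh (T : finType) (e : rel T) : R :=
  sup [set a | exists2 y, sqnorm y = 1 & a = quad e y]%classic.

Lemma top_rayleighP (T : finType) (e : rel T) :
  symmetric e -> irreflexive e -> (0 < #|T|)%N ->
  exists x : T -> R,
    [/\ 0 <= top_rayleigh e, forall u, 0 <= x u, sqnorm x = 1,
        forall u, adjsum e x u = top_rayleigh e * x u &
        forall y, quad e y <= top_rayleigh e * sqnorm y].
Proof.
move=> es ei T0; have [rho [x [rho0 x0 x1 xe xq]]] := perron R es ei T0.
suff -> : top_rayleigh e = rho by exists x.
apply: sup_max.
  exists x => //; rewrite quadE -[LHS]mulr1 -x1 /sqnorm mulr_sumr.
  by apply: eq_bigr => u _; rewrite xe; ring.
by move=> a [y y1 ->]; have := xq y; rewrite y1 mulr1.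
Qed.

Lemma spectral_radiusE (G : sgraph) : (0 < #|G|)%N ->
  spectral_radius R G = top_rayleigh (@adj G).
Proof.
move=> G0; have [x [rho0 x0 x1 xe xq]] := top_rayleighP (@adj_sym G) (@adj_irrefl G) G0.
apply: sup_max.
  apply/eigenvalueP; exists (\row_i x (enum_val i)).
    apply/rowP => j; rewrite !mxE.
    rewrite -xe /adjsum [RHS](reindex_onto enum_val enum_rank) /=; last first.
      by move=> i _; rewrite enum_rankK.
    rewrite [RHS](eq_bigl xpredT) => [|i]; last by rewrite enum_valK eqxx.
    by apply: eq_bigr => i _; rewrite !mxE adj_sym mulrC.
  apply/eqP => /rowP x00; move: x1; rewrite /sqnorm big1 => [/eqP|u _].
    by rewrite eq_sym oner_eq0.
  by have := x00 (enum_rank u); rewrite !mxE enum_rankK => ->; rewrite expr0n.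
move=> a /eigenvalueP[v va vN0].
pose y u := v ord0 (enum_rank u).
have y0 : 0 < sqnorm y.
  rewrite lt_def sqnorm_ge0 andbT; apply: contra vN0 => /eqP/sqnorm_eq0 y0.
  apply/eqP/rowP => i; rewrite mxE -(ord1 ord0).
  by have := y0 (enum_val i); rewrite /y enum_valK.
have ya u : adjsum (@adj G) y u = a * y u.
  have /rowP/(_ (enum_rank u)) := va; rewrite !mxE => <-.
  rewrite /adjsum (reindex_onto enum_val enum_rank) /=; last first.
    by move=> i _; rewrite enum_rankK.
  rewrite (eq_bigl xpredT) => [|i]; last by rewrite enum_valK eqxx.
  by apply: eq_bigr => i _; rewrite !mxE enum_rankK adj_sym mulrC /y enum_valK.
rewrite -(ler_pM2r y0); apply: le_trans (xq y).
rewrite quadE /sqnorm mulr_sumr le_eqVlt; apply/orP; left; apply/eqP.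
by apply: eq_bigr => u _; rewrite ya; ring.
Qed.

Section Induced.
Variables (G : sgraph).
Implicit Types (U : {set G}) (x y : G -> R).

Definition induced U : rel G := fun u v => [&& u \in U, v \in U & adj u v].

Lemma induced_sym U : symmetric (induced U).
Proof. by move=> u v; rewrite /induced adj_sym andbCA. Qed.

Lemma induced_irrefl U : irreflexive (induced U).
Proof. by move=> u; rewrite /induced adj_irrefl !andbF. Qed.

Definition lam U : R := top_rayleigh (induced U).

Lemma lamP U : (0 < #|G|)%N ->
  exists x : G -> R,
    [/\ 0 <= lam U, forall u, 0 <= x u, sqnorm x = 1,
        forall u, adjsum (induced U) x u = lam U * x u &
        forall y, quad (induced U) y <= lam U * sqnorm y].
Proof. exact: (top_rayleighP (@induced_sym U) (@induced_irrefl U)). Qed.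

Lemma lam_setT : (0 < #|G|)%N -> lam [set: G] = spectral_radius R G.
Proof.
move=> G0; rewrite spectral_radiusE // /lam; congr top_rayleigh.
by apply: funext => u; apply: funext => v; rewrite /induced !inE.
Qed.

Lemma adjsum_induced U x u : u \in U ->
  adjsum (induced U) x u = \sum_(v in U :&: neighbors u) x v.
Proof.
move=> uU; rewrite /adjsum [RHS]big_mkcond /=; apply: eq_bigr => v _.
rewrite /induced uU !inE /=.
by case: (_ && _); rewrite (mul1r, mul0r).
Qed.

Lemma adjsum_adj x u : adjsum (@adj G) x u = \sum_(v in neighbors u) x v.
Proof.
rewrite /adjsum [RHS]big_mkcond /=; apply: eq_bigr => v _.
by rewrite inE; case: adj; rewrite (mul1r, mul0r).
Qed.

Lemma lam_le_card U : (0 < #|G|)%N -> lam U <= #|U|%:R.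
Proof.
move=> G0; have [x [l0 x0 x1 xe xq]] := lamP U G0.
have [l00|lN0] := eqVneq (lam U) 0; first by rewrite l00.
have lpos : 0 < lam U by rewrite lt_def lN0.
have xU u : u \notin U -> x u = 0.
  move=> uU; have := xe u; rewrite /adjsum big1 => [/esym/eqP|v _].
    by rewrite mulf_eq0 (negPf lN0) => /eqP.
  by rewrite /induced (negPf uU) mul0r.
have [u0 _] : exists u, u \in G by apply/card_gt0P.
have [u _ umax] := @Order.TotalTheory.arg_maxP _ _ _ u0 xpredT x isT.
have xu : 0 < x u.
  rewrite lt_def x0 andbT; apply/eqP => xu0; move: x1.
  rewrite /sqnorm big1 => [/eqP|v _]; first by rewrite eq_sym oner_eq0.
  have /eqP -> : x v == 0 by rewrite eq_le x0 andbT -{1}xu0; exact: umax.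
  by rewrite expr0n.
have uU : u \in U by apply: contraTT xu => /xU->; rewrite ltxx.
rewrite -(ler_pM2r xu) -xe adjsum_induced // mulr_natl.
apply: le_trans (_ : \sum_(v in U :&: neighbors u) x u <= _).
  by apply: ler_sum => v _; apply: umax.
rewrite sumr_const; apply: ler_wpMn2l; first exact: ltW.
by apply: subset_leq_card; apply: subsetIl.
Qed.

Lemma dense_subset (U0 : {set G}) (b : R) : (0 < #|G|)%N -> 0 < b ->
  b * #|U0|%:R < lam U0 ->
  exists U : {set G},
    [/\ U \subset U0, b * #|U|%:R + (lam U0 - b * #|U0|%:R) <= lam U &
        forall v, v \in U ->
          b * lam U ^+ 2 <= #|U :&: neighbors v|%:R *
            (lam U + b * (1 - #|U|%:R + #|U :&: neighbors v|%:R))].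
Proof.
move=> G0 b0 lU0.
have [U sU Umax] := @Order.TotalTheory.arg_maxP _ _ _ U0 (fun U => U \subset U0)
  (fun U => lam U - b * #|U|%:R) (subxx _).
have UU0 := Umax U0 (subxx _); exists U; split=> //; first by move: UU0 => /=; lra.
move=> v vU; set d : R := #|U :&: neighbors v|%:R; have [x [l0 x0 x1 xe xq]] := lamP U G0.
have k0 : 0 <= b * #|U|%:R by rewrite mulr_ge0 ?ler0n // ltW.
have lpos : 0 < lam U by move: UU0 => /=; lra.
have low u : u \in U -> b <= (lam U + b) * x u ^+ 2.
  move=> uU; pose y w := x w + (- x u) * (w == u)%:R.
  have yu : y u = 0 by rewrite /y eqxx mulr1 subrr.
  have qy : quad (induced (U :\ u)) y = lam U - 2 * lam U * x u ^+ 2.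
    transitivity (quad (induced U) y).
      apply: eq_bigr => w _; apply: eq_bigr => z _.
      have [->|wu] := eqVneq w u; first by rewrite yu !(mulr0, mul0r).
      have [->|zu] := eqVneq z u; first by rewrite yu !mulr0.
      by rewrite /induced !inE wu zu.
    rewrite /y quad_shift; [|exact: induced_sym|exact: induced_irrefl].
    rewrite xe quadE (eq_bigr (fun w => lam U * x w ^+ 2)); last by move=> w _; rewrite xe; ring.
    by rewrite -mulr_sumr -/(sqnorm x) x1; ring.
  have ny : sqnorm y = 1 - x u ^+ 2 by rewrite /y sqnorm_shift x1; ring.
  have [_ [_ _ _ _ /(_ y)]] := lamP (U :\ u) G0; rewrite qy ny.
  have := Umax (U :\ u); rewrite /= (fintype.subset_trans (subsetDl _ _) sU) => /(_ isT).
  rewrite (cardsD1 u U) uU natrD mulrDr mulr1 => Hm Hq.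
  have ny0 := sqnorm_ge0 y; rewrite ny in ny0.
  have : lam (U :\ u) * (1 - x u ^+ 2) <= (lam U - b) * (1 - x u ^+ 2).
    by apply: ler_wpM2r => //; lra.
  by move: Hq; lra.
set N := U :&: neighbors v in d *; set M := U :\: neighbors v.
have cU : #|U|%:R = d + #|M|%:R :> R.
  by rewrite /d -natrD cardsID.
have CS := sqr_sum_le N x.
have xv : \sum_(w in N) x w = lam U * x v by rewrite -xe adjsum_induced.
have sN : \sum_(w in N) x w ^+ 2 <= 1 - \sum_(w in M) x w ^+ 2.
  rewrite lerBrDr -(big_setID (neighbors v)) -x1 /sqnorm big_mkcond /=.
  by apply: ler_sum => w _; case: ifP => // _; apply: sqr_ge0.
have sM : #|M|%:R * b <= (lam U + b) * \sum_(w in M) x w ^+ 2.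
  rewrite mulr_natl -sumr_const mulr_sumr; apply: ler_sum => w.
  by rewrite inE => /andP[_ /low].
have lb0 : 0 < lam U + b by lra.
have d0 : 0 <= d by apply: ler0n.
rewrite xv in CS; set X := \sum_(w in N) _ in CS sN; set S := \sum_(w in M) _ in sN sM.
have h1 : b * lam U ^+ 2 <= (lam U + b) * (lam U * x v) ^+ 2.
  rewrite -subr_ge0.
  have -> : (lam U + b) * (lam U * x v) ^+ 2 - b * lam U ^+ 2 =
            lam U ^+ 2 * ((lam U + b) * x v ^+ 2 - b) by ring.
  by rewrite mulr_ge0 ?sqr_ge0 // subr_ge0 low.
have h2 : (lam U + b) * (lam U * x v) ^+ 2 <= (lam U + b) * (d * X).
  by apply: (ler_wpM2l _ CS); apply: ltW.
have h3 : d * ((lam U + b) * X) <= d * (lam U + b - #|M|%:R * b).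
  apply: ler_wpM2l => //; apply: le_trans (_ : (lam U + b) * (1 - S) <= _); last lra.
  by apply: (ler_wpM2l _ sN); apply: ltW.
by rewrite cU; lra.
Qed.

End Induced.
End Spectral.

(** * Optimality of neighbourhoods in an extremal graph *)

Section Rewire.
Variable G : sgraph.
Implicit Types (N Q : {set G}).

Definition rich t N := forall Q, #|Q| <= t ->
  exists2 u, u \notin Q & forall w, w \in Q -> w \in N -> adj u w.

Lemma richS t N N' : N' \subset N -> rich t N -> rich t N'.
Proof.
move=> /subsetP NN richN Q /richN[u uQ uN]; exists u => // w wQ /NN; exact: uN.
Qed.

Variables (v : G) (N : {set G}).

Definition rewire_rel : rel G := fun a b =>
  (a != b) && (if a == v then b \in N else if b == v then a \in N else adj a b).

Lemma rewire_rel_sym : symmetric rewire_rel.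
Proof.
move=> a b; rewrite /rewire_rel (eq_sym b a) (adj_sym b a); congr (_ && _).
by case: (eqVneq a v) => [Ea|_]; case: (eqVneq b v) => [Eb|_]; rewrite ?Ea ?Eb.
Qed.

Lemma rewire_rel_irrefl : irreflexive rewire_rel.
Proof. by move=> a; rewrite /rewire_rel eqxx. Qed.

Definition rewire : sgraph := SGraph rewire_rel_sym rewire_rel_irrefl.

(* In a copy of a forbidden graph [v] can be replaced by a vertex that richness provides. *)
Lemma rewire_free t (I : finType) (F : I -> sgraph) :
  (forall i, #|F i| <= t) -> rich t N -> family_free F G -> family_free F rewire.
Proof.
move=> Ft richN Gfree i [f fi fa]; apply: (Gfree i).
pose Q := f @: [set: F i] : {set G}.
have [|u uQ uN] := richN Q.
  by apply: leq_trans (leq_imset_card _ _) _; rewrite cardsT.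
have fQ y : f y \in Q by apply: imset_f; rewrite inE.
have fu y : f y != u by apply: contraNneq uQ => <-.
exists (fun y => if f y == v then u else f y) => [y z|y z yz].
  case: eqP => [Ey|_]; case: eqP => [Ez|_].
  - by move=> _; apply: fi; rewrite Ey Ez.
  - by move=> /esym/eqP; rewrite (negPf (fu z)).
  - by move=> /eqP; rewrite (negPf (fu y)).
  - exact: fi.
have := fa y z yz; rewrite /= /rewire_rel => /andP[yzN].
case: eqP => [Ey|_]; case: eqP => [Ez|_] //.
- by rewrite Ey Ez eqxx in yzN.
- exact: uN.
- by rewrite adj_sym; exact: uN.
Qed.

End Rewire.

Section Weights.
Local Open Scope ring_scope.
Variables (R : realType) (G : sgraph).
Implicit Types (x : G -> R) (N A : {set G}).

Definition wt x A : R := \sum_(u in A) x u.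

Definition optimal t x := forall v N, v \notin N -> rich t N ->
  wt x N <= wt x (neighbors v) /\
  (0 < x v -> wt x N = wt x (neighbors v) -> N = neighbors v).

Lemma spex_optimal (n t : nat) (I : finType) (F : I -> sgraph) x rho :
  (0 < #|G|)%N -> (forall i, #|F i| <= t)%N -> SPEX R n F G ->
  rho = spectral_radius R G -> 0 < rho -> (forall u, 0 <= x u) ->
  (forall u, wt x (neighbors u) = rho * x u) -> optimal t x.
Proof.
move=> G0 Ft [Gn Gfree Gmax] Erho rho0 x0 xe v N vN richN.
pose H := rewire v N.
have rhoH : spectral_radius R H <= rho.
  by rewrite Erho; apply: Gmax => //; apply: rewire_free Gfree.
have bound (y : G -> R) : quad (@adj H) y <= rho * sqnorm y.
  have [_ [_ _ _ _ /(_ y)]] := @top_rayleighP R H _ (@adj_sym H) (@adj_irrefl H) G0.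
  rewrite -spectral_radiusE // => /le_trans; apply.
  by apply: ler_wpM2r => //; apply: sqnorm_ge0.
have aG u : adjsum (@adj G) x u = rho * x u by rewrite -xe adjsum_adj.
have aH : adjsum (@adj H) x v = wt x N.
  rewrite /adjsum /wt [RHS]big_mkcond; apply: eq_bigr => w _ /=.
  rewrite /rewire_rel eqxx; have [->|vw] := eqVneq w v.
    by rewrite (negPf vN) mul0r.
  by case: ifP => _; rewrite (mul1r, mul0r).
have qG : quad (@adj G) x = rho * sqnorm x.
  by rewrite quadE /sqnorm mulr_sumr; apply: eq_bigr => u _; rewrite aG; ring.
have qH : quad (@adj H) x = quad (@adj G) x + 2 * x v * (wt x N - rho * x v).
  pose y u := x u + (- x v) * (u == v)%:R.
  have yv : y v = 0 by rewrite /y eqxx mulr1 subrr.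
  have E1 : quad (@adj H) y = quad (@adj G) y.
    apply: eq_bigr => a _; apply: eq_bigr => b _ /=.
    rewrite /rewire_rel; have [->|av] := eqVneq a v; first by rewrite yv !(mulr0, mul0r).
    have [->|bv] := eqVneq b v; first by rewrite yv !mulr0.
    by case: eqP => [->|]; rewrite ?adj_irrefl.
  move: E1; rewrite /y !quad_shift; try solve [exact: adj_sym|exact: adj_irrefl].
  by rewrite aH aG; lra.
set D := wt x N - rho * x v in qH.
have := rayleigh_defect x v (@adj_sym H) (@adj_irrefl H) rho0 bound.
rewrite aH qH qG -/D => defect.
have D2 : 0 <= D ^+ 2 / rho by rewrite divr_ge0 ?sqr_ge0 // ltW.
have D0 : D <= 0.
  rewrite leNgt; apply/negP => Dpos.
  have : 0 < D ^+ 2 / rho by rewrite divr_gt0 ?exprn_gt0.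
  have : 0 <= 2 * x v * D by rewrite mulr_ge0 ?mulr_ge0 // ltW.
  by lra.
split; first by rewrite xe; move: D0; rewrite /D; lra.
move=> xv; rewrite xe => Dz.
have {}Dz : D = 0 by rewrite /D Dz subrr.
have eigH : forall w, adjsum (@adj H) x w = rho * x w.
  apply: rayleigh_eigen => //; [exact: (@adj_sym H)|exact: (@adj_irrefl H)|].
  by rewrite qH qG Dz mulr0 addr0.
apply/setP => w; rewrite inE adj_sym.
have [->|wv] := eqVneq w v; first by rewrite (negPf vN) adj_irrefl.
have := eigH w; rewrite -aG /adjsum (bigD1 v) //= [in RHS](bigD1 v) //=.
rewrite (eq_bigr (fun z => (adj w z)%:R * x z)); last first.
  move=> z zv; rewrite /rewire_rel (negPf wv) (negPf zv).
  by case: eqP => [->|]; rewrite ?adj_irrefl.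
move/addIr/(mulIf (lt0r_neq0 xv)); rewrite /rewire_rel wv (negPf wv) eqxx /=.
by case: (w \in N); case: (adj w v) => //= /eqP; rewrite ?oner_eq0 // eq_sym oner_eq0.
Qed.

End Weights.

(** * The hub partition *)

Lemma others_rich (G : sgraph) t r (V : nat -> {set G}) d i : i < r ->
  (forall j w, j < r -> j != i -> w \in V j -> #|V i :\: neighbors w| <= d) ->
  t * d + t < #|V i| -> rich t (others r V i).
Proof.
move=> ir Vd big Q Qt; pose P := Q :&: others r V i.
have cP : #|P| <= t by apply: leq_trans Qt; apply: subset_leq_card; apply: subsetIl.
have Pd w : w \in P -> #|V i :\: neighbors w| <= d.
  by rewrite inE => /andP[_ /othersP[j [jr ji wV]]]; apply: Vd wV.
have := common_neighbors Pd; set C := V i :&: _ => cC.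
have {}cC : #|Q| < #|C| by have := leq_mul cP (leqnn d); lia.
have /subsetPn[u uC uQ] : ~~ (C \subset Q).
  by apply: contraL cC => /subset_leq_card; rewrite leqNgt.
exists u => // w wQ wN; rewrite adj_sym.
by apply: (common_neighbors_joined _ uC); rewrite inE wQ.
Qed.

Section HubPartition.
Local Open Scope ring_scope.
Variables (R : realType) (G : sgraph) (x : G -> R).
Implicit Types (V : nat -> {set G}) (A B : {set G}).

Definition hub_partition r E n b V B :=
  [/\ forall i, (i < r)%N -> (n <= 8 * r * #|V i|)%N,
      forall i j, (i < r)%N -> (j < r)%N -> i != j -> [disjoint V i & V j],
      (B = ~: (\bigcup_(i < r) V i)) /\ (#|B| < b)%N,
      forall i v, (i < r)%N -> v \in V i ->
        (E * #|V i :&: neighbors v| <= n)%N /\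
        (E * #|others r V i :\: neighbors v| <= n)%N &
      forall i w, (i < r)%N -> w \in B -> (n <= 5 * E * #|V i :&: neighbors w|)%N].

Hypotheses (x0 : forall u, 0 <= x u) (x1 : forall u, x u <= 1).

Lemma wt_le_card A : wt x A <= #|A|%:R.
Proof. by rewrite -sum1_card natr_sum; apply: ler_sum. Qed.

Lemma wtS A B : A \subset B -> wt x A <= wt x B.
Proof.
move=> /fintype.subsetP AB; rewrite /wt [leLHS]big_mkcond [leRHS]big_mkcond /=.
by apply: ler_sum => u _; case: ifP => [/AB->//|_]; case: ifP.
Qed.

Lemma wtID B A : wt x A = wt x (A :&: B) + wt x (A :\: B).
Proof. exact: big_setID. Qed.

Lemma wtU A B : wt x (A :|: B) <= wt x A + wt x B.
Proof.
rewrite (wtID A) setUK setDUl setDv set0U lerD2l; apply: wtS; exact: subsetDl.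
Qed.

Lemma card_le_wt A : (forall u, 1 <= 4 * x u) -> #|A|%:R <= 4 * wt x A.
Proof.
move=> x4; rewrite -sum1_card natr_sum mulr_sumr; apply: ler_sum => u _.
by have := x4 u; lra.
Qed.

Variables (r t q : nat) (rho : R) (V : nat -> {set G}).
Hypotheses (r2 : (2 <= r)%N) (q32 : (32 <= q)%N) (qrt : (16 * r * t <= q)%N).
Hypotheses (G32 : (32 <= #|G|)%N) (Gqrt : (16 * r * t < #|G|)%N).
Hypotheses (NT : near_turan (8 * r) r q #|G| V [set: G]).
Hypotheses (xe : forall u, wt x (neighbors u) = rho * x u).
Hypotheses (rhoG : #|G|%:R <= 4 * rho) (xopt : optimal t x) (xmax : exists u, x u = 1).

Let W := ~: \bigcup_(i < r) V i.

Lemma neighbors_wt_lower i v : (i < r)%N ->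
  wt x [set: G] - wt x (V i) - #|W|%:R - 1 <= wt x (neighbors v).
Proof.
move=> ir; case: NT => Vn Vd Vc Vi Vo.
have richO : rich t (others r V i).
  apply: (@others_rich _ _ _ _ (#|G| %/ q)) => // [j w jr ji wV|].
    rewrite leq_divRL; last lia.
    rewrite mulnC; apply: leq_trans (Vo j w jr wV); rewrite leq_mul2l; apply/orP; right.
    apply: subset_leq_card; apply: setSD; apply/fintype.subsetP => z zV.
    by apply/othersP; exists i; rewrite eq_sym.
  have [_ c1] := Vn i ir; have c2 := leq_divM #|G| q.
  have := leq_mul qrt (leqnn (#|G| %/ q)); move: c1 c2 Gqrt; clear -r2; nia.
have vO : v \notin others r V i :\ v by rewrite !inE eqxx.
have [h _] := xopt vO (richS (subsetDl _ _) richO).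
apply: le_trans h.
have c1 : wt x (others r V i) <= wt x (others r V i :\ v) + 1.
  rewrite (wtID [set v]) addrC lerD2l; apply: le_trans (wt_le_card _) _.
  by rewrite lern1 (leq_trans (subset_leq_card (subsetIr _ _))) ?cards1.
have c2 : wt x [set: G] <= wt x (V i) + (wt x (others r V i) + wt x W).
  apply: le_trans (_ : wt x (V i :|: (others r V i :|: W)) <= _).
    apply: wtS; apply/fintype.subsetP => z _; rewrite !inE.
    case: (boolP (z \in \bigcup_(i0 < r) V i0)) => [/bigcupP_nat[j jr zV]|]; rewrite ?orbT //.
    have [Eji|ji] := eqVneq j i; first by rewrite -Eji zV.
    by apply/orP; right; apply/orP; left; apply/othersP; exists j.
  by apply: le_trans (wtU _ _) _; rewrite lerD2l wtU.
by have := wt_le_card W; lra.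
Qed.

Lemma exceptional_card : (q * #|W| <= #|G|)%N.
Proof.
by case: NT => _ _ + _ _; rewrite setTD.
Qed.

Lemma weight_lower v : 1 <= 4 * x v.
Proof.
case: NT => Vn Vd _ _ _.
have [i ir hi] : exists2 i, (i < r)%N & 2 * wt x (V i) <= wt x [set: G].
  have : wt x (V 0%N) + wt x (V 1%N) <= wt x [set: G].
    apply: le_trans (wtS (subsetT (V 0%N :|: V 1%N))).
    rewrite [leRHS](wtID (V 0%N)) setUK lerD2l; apply: wtS.
    apply/fintype.subsetP => z z1; rewrite !inE z1 orbT andbT.
    have : [disjoint V 1%N & V 0%N] by apply: Vd; lia.
    by move/disjointFr => ->.
  case: (leP (wt x (V 0%N)) (wt x (V 1%N))) => h1 h2; [exists 0%N|exists 1%N]; try lra; lia.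
have := neighbors_wt_lower v ir; rewrite xe => h1.
have [u xu] := xmax.
have h2 : rho <= wt x [set: G] by rewrite -[rho]mulr1 -xu -xe; apply: wtS; apply: subsetT.
have h3 : 32 * #|W|%:R <= #|G|%:R :> R.
  by rewrite -natrM ler_nat; apply: leq_trans exceptional_card; rewrite leq_mul2r q32 orbT.
have h4 : 32 <= #|G|%:R :> R by rewrite ler_nat.
have h5 : #|G|%:R <= 4 * rho := rhoG.
have rho0 : 0 < rho by lra.
rewrite -(ler_pM2l rho0); lra.
Qed.

Lemma missing_upper i v : (i < r)%N ->
  (#|~: neighbors v :\: V i| <= 4 * (#|W| + 1 + #|V i :&: neighbors v|))%N.
Proof.
move=> ir; rewrite -(ler_nat R) natrM 2!natrD.
apply: le_trans (card_le_wt _ weight_lower) _; rewrite ler_pM2l //.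
have := neighbors_wt_lower v ir.
have := wtID (neighbors v) [set: G]; rewrite setTI setTD.
have := wtID (V i) (~: neighbors v); have := wtID (neighbors v) (V i).
have := wt_le_card (V i :&: neighbors v).
rewrite (_ : ~: neighbors v :&: V i = V i :\: neighbors v); last by rewrite setDE setIC.
lra.
Qed.

End HubPartition.

Lemma hub_partition_exists (R : realType) (G : sgraph) (x : G -> R) r t E q rho V :
  (forall u, 0 <= x u)%R -> (forall u, x u <= 1)%R -> (exists u, x u = 1)%R ->
  (forall u, wt x (neighbors u) = rho * x u)%R -> (#|G|%:R <= 4 * rho)%R ->
  optimal t x -> 2 <= r -> 0 < t -> 10 * r <= E ->
  16 * (5 * E) * 2 ^ (t * (2 * (5 * E)) ^ r) * (t + t * r) <= q -> q + 32 <= #|G| ->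
  ~ path_multipartite G t r.-1 -> near_turan (8 * r) r q #|G| V [set: G] ->
  exists (V' : nat -> {set G}) (B : {set G}), hub_partition r E #|G| (t * (2 * (5 * E)) ^ r) V' B.
Proof.
move=> x0 x1 xmax xe rhoG xopt r2 t0 Er; set D := 5 * E; set b := t * (2 * D) ^ r.
move=> qbig Gq npm NT; set n := #|G| in Gq NT *.
have D48 : 48 * r < D by rewrite /D; lia.
have e1 : 16 * D * (t + t * r) <= q.
  by apply: leq_trans qbig; rewrite [leqRHS]mulnAC leq_pmulr // expn_gt0.
have qD : 16 * D <= q by apply: leq_trans e1; rewrite leq_pmulr //; lia.
have qrt : 16 * r * t <= q by apply: leq_trans e1; nia.
have q32 : 32 <= q by lia.
have G32 : 32 <= n by lia.
have Gqrt : 16 * r * t < n by lia.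
have miss i v : i < r -> _ := @missing_upper R G x x0 x1 r t q rho V
  r2 q32 qrt G32 Gqrt NT xe rhoG xopt xmax i v.
have cW : q * #|~: (\bigcup_(i < r) V i)| <= n := exceptional_card NT.
have [Vn Vd _ Vi Vo] := NT; set W := ~: _ in miss cW.
have Dmiss i v : i < r -> D * #|V i :&: neighbors v| <= n ->
    D * #|~: neighbors v :\: V i| <= 5 * n.
  move=> ir lt; have c1 := leq_mul (leqnn D) (miss i v ir).
  have c2 : 16 * D * #|W| <= n by apply: leq_trans cW; rewrite leq_mul2r qD orbT.
  by move: c1 c2 lt qD Gq; clear; lia.
pose V' i := [set v | D * #|V i :&: neighbors v| < n].
have VV' i : i < r -> V i \subset V' i.
  move=> ir; apply/fintype.subsetP => v vV; rewrite inE.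
  have c1 := Vi i v ir vV.
  have c2 : 16 * D * #|V i :&: neighbors v| <= n by apply: leq_trans c1; rewrite leq_mul2r qD orbT.
  by move: c2 Gq; clear; lia.
have V'd i j : i < r -> j < r -> i != j -> [disjoint V' i & V' j].
  move=> ir jr ij; rewrite disjoint_subset; apply/fintype.subsetP => v.
  rewrite !inE => vi; apply/negP => vj.
  have c1 := Dmiss i v ir (ltnW vi).
  have c2 : #|V j :\: neighbors v| <= #|~: neighbors v :\: V i|.
    apply: subset_leq_card; apply/fintype.subsetP => z; rewrite !inE => /andP[-> zj].
    by rewrite andbT (disjointFl (Vd i j ir jr ij)).
  have c3 := cardsID (neighbors v) (V j); have [_ c4] := Vn j jr.
  have c5 : D * #|V j| <= 6 * n by have := leq_mul (leqnn D) c2; rewrite -c3; move: c1 vj; clear; lia.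
  have c6 : D * n <= 48 * r * n.
    by have := leq_mul (leqnn D) c4; have := leq_mul (leqnn (8 * r)) c5; clear; lia.
  by move: c6; rewrite leq_pmul2r; lia.
have VW i : i < r -> V' i :\: V i \subset W.
  move=> ir; apply/fintype.subsetP => z; rewrite inE => /andP[zV zV'].
  rewrite inE; apply/bigcupP_nat => -[j jr zj].
  have [Eij|ij] := eqVneq i j; first by rewrite Eij zj in zV.
  by have := disjointFr (V'd i j ir jr ij) zV'; rewrite (fintype.subsetP (VV' j jr) z zj).
have V'miss i v : i < r -> v \in V' i -> E * #|others r V' i :\: neighbors v| <= n.
  rewrite inE => ir /ltnW/(Dmiss i v ir) c1.
  have c2 : #|others r V' i :\: neighbors v| <= #|~: neighbors v :\: V i|.
    apply: subset_leq_card; apply/fintype.subsetP => z; rewrite !inE => /andP[-> /othersP[j [jr ji zj]]].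
    rewrite andbT; apply/negP => /(fintype.subsetP (VV' i ir)) zi.
    by have := disjointFr (V'd j i jr ir ji) zj; rewrite zi.
  by have := leq_mul (leqnn D) c2; move: c1; rewrite /D; clear; lia.
exists V', (~: (\bigcup_(i < r) V' i)).
have hub w i : i < r -> w \notin \bigcup_(i < r) V' i -> n <= D * #|V i :&: neighbors w|.
  move=> ir wB; rewrite leqNgt; apply: contra wB => lt.
  by apply/bigcupP_nat; exists i => //; rewrite inE.
split.
- move=> i ir; apply: leq_trans (Vn i ir).2 _; rewrite leq_mul2l; apply/orP; right.
  by apply: subset_leq_card; apply: VV'.
- exact: V'd.
- split=> //; apply: (@few_hubs G r t D n V _ (n %/ q)) => //; try lia.
  + move=> k l v kr lr kl vV; rewrite leq_divRL; last lia.
    rewrite mulnC; apply: leq_trans (Vo k v kr vV); rewrite leq_mul2l; apply/orP; right.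
    apply: subset_leq_card; apply: setSD; apply/fintype.subsetP => z zV.
    by apply/othersP; exists l; rewrite eq_sym.
  + by move=> w i; rewrite inE => wB ir; apply: hub.
  + have c1 := leq_divM n q.
    have c2 := leq_mul qbig (leqnn (n %/ q)).
    have c3 : 16 * D * 2 ^ b * t <= q.
      by apply: leq_trans qbig; rewrite leq_mul2l leq_addr orbT.
    move: c1 c2 c3 Gq; rewrite -/D -/b; set X := 2 ^ b; set Y := n %/ q; clear.
    by lia.
- move=> i v ir vV'; split; last exact: V'miss.
  have c1 : #|V' i :&: neighbors v| <= #|V i :&: neighbors v| + #|W|.
    apply: (@leq_trans #|(V i :&: neighbors v) :|: W|); last exact: leq_of_leqif (leq_card_setU _ _).
    apply: subset_leq_card; apply/fintype.subsetP => z; rewrite !in_setU !in_setI => /andP[zV' ->].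
    case: (boolP (z \in V i)) => //= zV; apply: (fintype.subsetP (VW i ir)).
    by rewrite in_setD zV.
  have c2 : 16 * D * #|W| <= n by apply: leq_trans cW; rewrite leq_mul2r qD orbT.
  move: vV'; rewrite inE => c3; have := leq_mul (leqnn D) c1.
  by move: c2 c3; rewrite /D; clear; lia.
move=> i w ir; rewrite inE => wB; apply: leq_trans (hub w i ir wB) _.
rewrite leq_mul2l; apply/orP; right; apply: subset_leq_card; apply: setSI; exact: VV'.
Qed.

(** * Spectral stability *)

Section SpectralStability.
Local Open Scope ring_scope.
Variable R : realType.

Lemma degree_gain (a c l b d e : R) : 1 / 2 <= a -> 0 < c -> a + c <= l -> l <= 1 ->
  b = a + c / 2 -> 0 <= d -> 0 <= e -> e < c / 20 ->
  b * l ^+ 2 <= d * (l + b * (e - 1 + d)) -> a + c / 20 <= d.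
Proof.
move=> a0 c0 al l1 Eb d0 e0 ec H; rewrite leNgt; apply/negP => dlt.
have b0 : 0 < b by lra.
have l0 : 0 < l by lra.
have P0 : 0 < l + b * (e - 1 + d).
  rewrite ltNge; apply/negP => P0.
  have : 0 < b * l ^+ 2 by rewrite mulr_gt0 // exprn_gt0.
  have : d * (l + b * (e - 1 + d)) <= 0 by rewrite mulr_ge0_le0.
  lra.
have H1 : d * (l + b * (e - 1 + d)) <= (a + c / 20) * (l + b * (e - 1 + (a + c / 20))).
  apply: ler_pM; [lra|exact: ltW|lra|].
  by rewrite lerD2l; apply: ler_wpM2l; lra.
have {H1}H := le_trans H H1.
pose m := l - (a + c); have m0 : 0 <= m by rewrite /m; lra.
have El : l = a + c + m by rewrite /m; ring.
have h1 : b * (a + c) ^+ 2 + (a + c / 20) * m <= b * l ^+ 2.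
  have p1 : (1 + c) * (a + c) <= 2 * b * (a + c) by apply: ler_wpM2r; lra.
  have p2 : 0 <= m * (2 * b * (a + c) - a - c / 20).
    by apply: mulr_ge0 => //; have := mulr_ge0 (ltW c0) (ltW c0); nra.
  have p3 : 0 <= b * m ^+ 2 by rewrite mulr_ge0 ?sqr_ge0 // ltW.
  by rewrite El; move: p2 p3; clear; lra.
have h2 : (a + c / 20) * (a + c + b * (e - 1 + (a + c / 20))) < b * (a + c) ^+ 2.
  have p1 : 0 <= c * (2 * a ^+ 2 + 2 * a * c + c ^+ 2 / 2 - a / 2 - 1 / 4).
    by apply: mulr_ge0; [lra|nra].
  have p2 : b * (c / 20 * (2 * a - 1) + (c / 20) ^+ 2) <= 1 * (2 * (c / 20)).
    by apply: ler_pM; [lra|nra|lra|nra].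
  have p3 : (b * (a + c / 20)) * e <= 1 * e.
    by apply: ler_wpM2r => //; nra.
  have p4 : c / 20 * (a + c) <= c / 20 * 1 by apply: ler_wpM2l; lra.
  by move: p1 p2 p3 p4 ec c0; rewrite Eb; clear; lra.
by move: H h1 h2; rewrite El; clear; lra.
Qed.

Lemma degree_stability (a n l b d e : R) : 1 / 2 <= a -> a <= 1 -> 0 < n -> n <= 1 / 4 ->
  a - e <= l -> l <= 1 -> b = a - n / 10 -> 0 <= d -> 0 <= e -> e < n / 40 ->
  b * l ^+ 2 <= d * (l + b * (e - 1 + d)) -> a - n <= d.
Proof.
move=> a0 a1 n0 n4 al l1 Eb d0 e0 en H; rewrite leNgt; apply/negP => dlt.
have b0 : 0 < b by lra.
have l0 : 0 < l by lra.
have P0 : 0 < l + b * (e - 1 + d).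
  rewrite ltNge; apply/negP => P0.
  have : 0 < b * l ^+ 2 by rewrite mulr_gt0 // exprn_gt0.
  have : d * (l + b * (e - 1 + d)) <= 0 by rewrite mulr_ge0_le0.
  lra.
have H1 : d * (l + b * (e - 1 + d)) <= (a - n) * (l + b * (e - 1 + (a - n))).
  apply: ler_pM; [lra|exact: ltW|lra|].
  by rewrite lerD2l; apply: ler_wpM2l; lra.
have {H1}H := le_trans H H1.
pose m := l - (a - e); have m0 : 0 <= m by rewrite /m; lra.
have El : l = a - e + m by rewrite /m; ring.
have h1 : b * (a - e) ^+ 2 + (a - n) * m <= b * l ^+ 2.
  have p1 : (1 - n / 5) * (a - e) <= 2 * b * (a - e) by apply: ler_wpM2r; lra.
  have p2 : 0 <= m * (2 * b * (a - e) - a + n).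
    by apply: mulr_ge0 => //; nra.
  have p3 : 0 <= b * m ^+ 2 by rewrite mulr_ge0 ?sqr_ge0 // ltW.
  by rewrite El; move: p2 p3; clear; lra.
have h2 : (a - n) * (a - e + b * (e - 1 + (a - n))) < b * (a - e) ^+ 2.
  have p1 : 0 <= n * (2 * a ^+ 2 - a / 10 - 6 / 5 * a * n + n ^+ 2 / 10 + n / 10 - 3 / 10).
    by apply: mulr_ge0; [lra|nra].
  have p2 : (2 * a * b + (a - n) * b) * e <= 3 * e.
    by apply: ler_wpM2r => //; nra.
  have p3 : 0 <= b * e ^+ 2 by rewrite mulr_ge0 ?sqr_ge0 // ltW.
  have p4 : 0 <= (a - n) * e by rewrite mulr_ge0 //; lra.
  by move: p1 p2 p3 p4 en n0; rewrite Eb; clear; lra.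
by move: H h1 h2; rewrite El; clear; lra.
Qed.

Definition turan_density r : R := 1 - r%:R^-1.

Lemma turan_density_ge r : (2 <= r)%N -> 1 / 2 <= turan_density r.
Proof.
move=> r2; rewrite /turan_density lerBrDr -lerBrDl.
have -> : 1 - 1 / 2 = 2^-1 :> R by field.
by rewrite lef_pV2 ?posrE ?ltr0n ?ler_nat //; lia.
Qed.

Lemma turan_density_lt1 r : (0 < r)%N -> turan_density r < 1.
Proof. by move=> r0; rewrite /turan_density ltrBlDr ltrDl invr_gt0 ltr0n. Qed.

Lemma normalized_degree (b l d k : R) : 0 < k ->
  b * l ^+ 2 <= d * (l + b * (1 - k + d)) ->
  b * (l / k) ^+ 2 <= (d / k) * (l / k + b * (k^-1 - 1 + d / k)).
Proof.
move=> k0 H; rewrite -(ler_pM2r (exprn_gt0 2 k0)).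
have -> : b * (l / k) ^+ 2 * k ^+ 2 = b * l ^+ 2 by field; rewrite gt_eqF.
have -> : (d / k) * (l / k + b * (k^-1 - 1 + d / k)) * k ^+ 2 = d * (l + b * (1 - k + d)).
  by field; rewrite gt_eqF.
by [].
Qed.

Lemma lam_upper r t (c : R) : (2 <= r)%N -> 0 < c ->
  exists k0, forall (G : sgraph) (U : {set G}), (k0 <= #|U|)%N ->
    ~ path_multipartite G t r.-1 -> lam R U <= (turan_density r + c) * #|U|%:R.
Proof.
move=> r2 c0; set a := turan_density r.
have r0 : (0 < r)%N by lia.
have a2 : 1 / 2 <= a by apply: turan_density_ge.
pose q := Num.bound (20 / c).
have cq : 20 / c < q%:R by apply: archi_boundP; apply: divr_ge0; lra.
have [n1 n1P] := erdos_stone r q t.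
pose k0 := Num.bound ((n1%:R + 20 / c + 1) * (2 / c)).
have n1R : 0 <= n1%:R :> R by [].
have ck0 : 0 <= 20 / c by apply: divr_ge0; lra.
have k0P : (n1%:R + 20 / c + 1) * (2 / c) < k0%:R.
  by apply: archi_boundP; apply: mulr_ge0; [lra|apply: divr_ge0; lra].
exists k0 => G U kU npm; rewrite leNgt; apply/negP => lU.
have {k0P}kU : (n1%:R + 20 / c + 1) * (2 / c) < #|U|%:R.
  by apply: lt_le_trans k0P _; rewrite ler_nat.
have {}kU : n1%:R + 20 / c + 1 < c / 2 * #|U|%:R.
  have -> : n1%:R + 20 / c + 1 = c / 2 * ((n1%:R + 20 / c + 1) * (2 / c)).
    by field; rewrite gt_eqF.
  by rewrite ltr_pM2l //; lra.
have Upos : 0 < #|U|%:R :> R.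
  by rewrite -(@pmulr_rgt0 _ (c / 2)); lra.
have G0 : (0 < #|G|)%N.
  by move: Upos; rewrite ltr0n => /leq_trans; apply; apply: max_card.
have b0 : 0 < a + c / 2 by lra.
have [|W [WU lW dW]] := dense_subset G0 b0 (U0 := U).
  by apply: le_lt_trans lU; rewrite ler_wpM2r // ; lra.
have cWU : #|W|%:R <= #|U|%:R :> R by rewrite ler_nat subset_leq_card.
have lW1 := lam_le_card R W G0.
have W0 : 0 <= #|W|%:R :> R by [].
set k : R := #|W|%:R in lW lW1 W0 dW cWU.
set u : R := #|U|%:R in lU kU Upos lW cWU.
have lWk : (a + c) * k <= lam R W.
  by have := @ler_wpM2l _ (c / 2) _ _ _ cWU; move: lW lU; clear -c0; lra.
have kc : c / 2 * u <= k.
  by have := mulr_ge0 (ltW b0) W0; move: lW lU lW1; clear; lra.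
have kpos : 0 < k by lra.
have kN : k != 0 by rewrite gt_eqF.
apply: (@npm); have [||A mA] := n1P G W; last exact: multipartite_path mA.
  by rewrite -(ler_nat R) -/k; lra.
move=> v vW.
have := normalized_degree kpos (dW v vW).
have := cardsID (neighbors v) W.
set dn := #|_ :&: _|; set mn := #|_ :\: _| => dm.
have dmR : dn%:R + mn%:R = k :> R by rewrite -natrD dm.
have e20 : k^-1 < c / 20.
  rewrite -[c / 20]invrK ltf_pV2 ?posrE ?invr_gt0 //; last lra.
  have -> : (c / 20)^-1 = 20 / c by field; rewrite gt_eqF.
  lra.
move/(degree_gain a2 c0) => /(_ _ _ erefl _ _ e20) H.
have {H} : a + c / 20 <= dn%:R / k.
  apply: H; rewrite ?invr_ge0 ?divr_ge0 //.
    by rewrite ler_pdivlMr.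
  by rewrite ler_pdivrMr // mul1r.
rewrite ler_pdivlMr // => H.
rewrite -(ler_nat R) natrD !natrM -/k.
have rR : 0 < r%:R :> R by rewrite ltr0n.
have ra : r%:R * a = r%:R - 1 by rewrite /a /turan_density; field; rewrite gt_eqF.
have qc : 20 <= q%:R * c by move: cq; rewrite ltr_pdivrMr // => /ltW.
have h1 : r%:R * (a + c / 20) * k <= r%:R * dn%:R by rewrite -mulrA ler_wpM2l // ltW.
have h2 : q%:R * (r%:R * (a + c / 20) * k) <= q%:R * (r%:R * dn%:R) by rewrite ler_wpM2l.
have h3 : r%:R * k * 20 <= r%:R * k * (q%:R * c) by rewrite ler_wpM2l // mulr_ge0 // ltW.
have -> : mn%:R = k - dn%:R :> R by lra.
move: h2; rewrite mulrDr ra => h2.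
by move: h2 h3; clear; lra.
Qed.

Lemma lt_bound (x : R) : 0 <= x -> exists n : nat, forall k, (n <= k)%N -> x < k%:R.
Proof.
move=> x0; exists (Num.bound x) => k kn; apply: lt_le_trans (archi_boundP x0) _.
by rewrite ler_nat.
Qed.

Lemma spectral_near_turan r t q : (0 < t)%N -> (2 <= r)%N -> (r <= q)%N ->
  exists n0, forall G : sgraph, (n0 <= #|G|)%N ->
    ~ path_multipartite G t r.-1 ->
    turan_density r * #|G|%:R - 1 <= spectral_radius R G ->
    exists V, near_turan (8 * r) r q #|G| V [set: G].
Proof.
move=> t0 r2 rq; set a := turan_density r.
have r0 : (0 < r)%N by lia.
have a2 : 1 / 2 <= a by apply: turan_density_ge.
have a1 : a < 1 by apply: turan_density_lt1.
have q2 : (2 * r <= 2 * q)%N by lia.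
have [h [n1 [h0 n1P]]] := near_turan_of_degree t0 r2 q2.
have hR : 0 < h%:R :> R by rewrite ltr0n.
have h1 : 1 <= h%:R :> R by rewrite ler1n.
pose n : R := (4 * h%:R)^-1.
have n0 : 0 < n by rewrite invr_gt0; lra.
have n4 : n <= 1 / 4.
  have -> : 1 / 4 = 4^-1 :> R by rewrite mul1r.
  by rewrite lef_pV2 ?posrE //; lra.
have q0 : 0 < q%:R :> R by rewrite ltr0n; lia.
have q1 : 1 <= q%:R :> R by rewrite ler1n; lia.
have c0 : 0 < n / (40 * q%:R) by rewrite divr_gt0 //; lra.
have [k0 k0P] := lam_upper t r2 c0.
have k0R : 0 <= k0%:R :> R by [].
have n1R : 0 <= n1%:R :> R by [].
have n40 : 0 < 40 / n by rewrite divr_gt0.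
have bound0 : 0 <= (k0%:R + n1%:R + 40 / n + 2) * (10 / n) * (4 * q%:R).
  by apply: mulr_ge0; [apply: mulr_ge0; [|apply: divr_ge0]|]; lra.
have [m0 m0P] := lt_bound bound0.
exists m0 => G mG npm rho.
have {m0P}mG := m0P _ mG.
set N : R := #|G|%:R in mG rho.
have {}mG : (k0%:R + n1%:R + 40 / n + 2) * (4 * q%:R) < n / 10 * N.
  have -> : (k0%:R + n1%:R + 40 / n + 2) * (4 * q%:R) =
     n / 10 * ((k0%:R + n1%:R + 40 / n + 2) * (10 / n) * (4 * q%:R)).
    by field; rewrite !gt_eqF.
  by rewrite ltr_pM2l //; lra.
have mG1 : k0%:R + n1%:R + 40 / n + 2 < n / 10 * N.
  apply: le_lt_trans mG; rewrite -[leLHS]mulr1; apply: ler_wpM2l; lra.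
have mG2 : 8 * q%:R < n / 10 * N.
  apply: le_lt_trans mG; rewrite mulrC.
  have : 2 * (4 * q%:R) <= (k0%:R + n1%:R + 40 / n + 2) * (4 * q%:R) by apply: ler_wpM2r; lra.
  by lra.
have Npos : 0 < N.
  by rewrite -(@pmulr_rgt0 _ (n / 10)); lra.
have G0 : (0 < #|G|)%N by rewrite -(ltr0n R).
have b0 : 0 < a - n / 10 by lra.
have [|U [_ lU dU]] := dense_subset G0 b0 (U0 := [set: G]).
  by rewrite lam_setT // cardsT -/N; lra.
rewrite lam_setT // cardsT -/N in lU.
have cU : #|U|%:R <= N by rewrite ler_nat max_card.
have lU1 := lam_le_card R U G0.
have U0 : 0 <= #|U|%:R :> R by [].
set k : R := #|U|%:R in lU lU1 U0 dU cU.
have bk : 0 <= (a - n / 10) * k by rewrite mulr_ge0 // ltW.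
have kbig : k0%:R + n1%:R + 40 / n < k by lra.
have kpos : 0 < k by lra.
have kN : k != 0 by rewrite gt_eqF.
have lUk : a * k + n / 10 * (N - k) - 1 <= lam R U by lra.
have lUk1 : a * k - 1 <= lam R U.
  have : 0 <= n / 10 * (N - k) by apply: mulr_ge0; lra.
  lra.
have deg v : v \in U -> (r * h * #|U :\: neighbors v| <= (h + r) * #|U|)%N.
  move=> vU; have := normalized_degree kpos (dU v vU).
  have := cardsID (neighbors v) U.
  set dn := #|_ :&: _|; set mn := #|_ :\: _| => dm.
  have dmR : dn%:R + mn%:R = k :> R by rewrite -natrD dm.
  have e40 : k^-1 < n / 40.
    rewrite -[n / 40]invrK ltf_pV2 ?posrE ?invr_gt0 //; last lra.
    have -> : (n / 40)^-1 = 40 / n by field; rewrite gt_eqF.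
    lra.
  move/(degree_stability a2 (ltW a1) n0 n4) => /(_ _ _ erefl _ _ e40) H.
  have {H} : a - n <= dn%:R / k.
    apply: H; rewrite ?invr_ge0 ?divr_ge0 //.
      by rewrite ler_pdivlMr // mulrBl mulVf.
    by rewrite ler_pdivrMr // mul1r.
  rewrite ler_pdivlMr // => H.
  rewrite -(ler_nat R) !natrM natrD -/k.
  have rR : 0 < r%:R :> R by rewrite ltr0n.
  have ra : r%:R * a = r%:R - 1 by rewrite /a /turan_density; field; rewrite gt_eqF.
  have hn : h%:R * n = 1 / 4 by rewrite /n; field; rewrite gt_eqF.
  have e1 : (r%:R * h%:R) * ((a - n) * k) <= (r%:R * h%:R) * dn%:R.
    by rewrite ler_wpM2l // mulr_ge0 // ltW.
  have e2 : (r%:R * h%:R) * ((a - n) * k) = h%:R * (r%:R * a) * k - r%:R * (h%:R * n) * k by ring.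
  rewrite e2 ra hn in e1.
  have -> : mn%:R = k - dn%:R :> R by lra.
  have rk : 0 <= r%:R * k :> R by rewrite mulr_ge0.
  by move: e1 rk; clear; lra.
have kn1 : (n1 <= #|U|)%N by rewrite -(ler_nat R) -/k; lra.
have kk0 : (k0 <= #|U|)%N by rewrite -(ler_nat R) -/k; lra.
have [V [vU dV cV iV oV]] := n1P G U kn1 npm deg.
have lUup := k0P G U kk0 npm.
have cNk : 2 * q%:R * (N - k) <= N.
  have e1 : n / 10 * (N - k) <= n / (40 * q%:R) * k + 1.
    by move: lUup lUk; rewrite -/k -/a; lra.
  have e2 : (20 * q%:R / n) * (n / 10 * (N - k)) <= (20 * q%:R / n) * (n / (40 * q%:R) * k + 1).
    by apply: ler_wpM2l e1; apply: divr_ge0; lra.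
  have e3 : (20 * q%:R / n) * (n / 10 * (N - k)) = 2 * q%:R * (N - k) by field; rewrite gt_eqF.
  have e4 : (20 * q%:R / n) * (n / (40 * q%:R) * k + 1) = k / 2 + 20 * q%:R / n.
    by field; rewrite !gt_eqF.
  have e5 : 20 * q%:R / n <= N / 2.
    rewrite ler_pdivrMr //; move: mG2; lra.
  by move: e2; rewrite e3 e4; lra.
have cNk' : (2 * q * (#|G| - #|U|) <= #|G|)%N.
  by rewrite -(ler_nat R) !natrM natrB ?max_card.
have kG : (#|U| <= #|G|)%N by apply: max_card.
have k2G : (#|G| <= 2 * #|U|)%N by move: cNk' kG rq r2; clear; nia.
exists V; split.
- move=> i ir; split; first exact: subsetT.
  by have [_] := vU i ir; move: k2G; clear; lia.
- exact: dV.
- have : (#|[set: G] :\: \bigcup_(i < r) V i| <= #|U :\: \bigcup_(i < r) V i| + (#|G| - #|U|))%N.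
    have -> : (#|G| - #|U| = #|~: U|)%N by rewrite -(cardsC U) addKn.
    apply: leq_trans (leq_card_setU _ _); apply: subset_leq_card; apply/fintype.subsetP => x.
    by rewrite !inE; case: (x \in U); rewrite /= ?andbT ?orbT ?orbF.
  by move: cV cNk' kG; clear; nia.
- by move=> i v ir vV; move: (iV i v ir vV) kG; clear; nia.
- by move=> i v ir vV; move: (oV i v ir vV) kG; clear; nia.
Qed.

End SpectralStability.

(** * Structure of the parts *)

Section Parts.
Import boolp.
Variables (R : realType) (G : sgraph) (x : G -> R) (r t E b : nat).
Variables (V : nat -> {set G}) (B : {set G}).
Hypotheses (x0 : forall u, (0 <= x u)%R) (x1 : forall u, (x u <= 1)%R).
Hypotheses (x4 : forall u, (1 <= 4 * x u)%R) (xopt : optimal t x).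
Hypotheses (r2 : 2 <= r) (t0 : 0 < t) (Er : 128 * r * (t + t * r) <= E).
Hypotheses (npm : ~ path_multipartite G t r.-1).
Hypotheses (HP : hub_partition r E #|G| b V B).
Implicit Types (A X Y C : {set G}).

Let n := #|G|.
Hypotheses (nE : 40 * E <= n).

Lemma part_missing i j v : i < r -> j < r -> i != j -> v \in V i ->
  #|V j :\: neighbors v| <= n %/ E.
Proof.
move=> ir jr ij vV; rewrite leq_divRL; last by move: Er r2 t0; clear; nia.
have [_ _ _ /(_ i v ir vV)[_ h] _] := HP.
rewrite mulnC; apply: leq_trans h; rewrite leq_mul2l; apply/orP; right.
apply: subset_leq_card; apply: setSD; apply/fintype.subsetP => z zV.
by apply/othersP; exists j; rewrite eq_sym.
Qed.

Lemma part_large m i : m <= 4 * (t + t * r) -> i < r -> m * (n %/ E) + t < #|V i|.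
Proof.
move=> mt ir; have [/(_ i ir) h _ _ _ _] := HP; rewrite -/n in h.
have c1 := leq_divM n E.
have c2 := leq_mul Er (leqnn (n %/ E)).
have c3 := leq_mul mt (leqnn (n %/ E)).
have c4 : 128 * r * (t + t * r) <= n by move: Er nE; clear; lia.
have r0 : 0 < 8 * r by lia.
rewrite -(ltn_pmul2l r0); apply: leq_trans h.
have := leq_mul (leqnn (8 * r)) c3.
by move: c1 c2 c4 t0 r2; set d := n %/ E; clearbody n d; clear; nia.
Qed.

Lemma part_path_free i : i < r -> ~ has_path t (V i).
Proof.
move=> ir [p [sp up ap pV]]; apply: npm.
pose ks := [seq k <- iota 0 r | k != i].
have ksP k : (k \in ks) = (k < r) && (k != i) by rewrite mem_filter mem_iota andbC.
pose P := [set z in p]; have cP : #|P| = t by rewrite cardsE (card_uniqP up).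
have [|||| A [AP AA]] := @greedy_parts G (n %/ E) t ks V P.
- by rewrite filter_uniq ?iota_uniq.
- move=> v l; rewrite inE ksP => /pV vV /andP[lr li].
  by apply: (@part_missing i) => //; rewrite eq_sym.
- move=> k l v; rewrite !ksP => /andP[kr _] /andP[lr _] kl vV.
  exact: (@part_missing k).
- move=> l; rewrite ksP => /andP[lr _]; apply: ltnW; apply: part_large => //.
  have h : size ks <= r by rewrite size_filter (leq_trans (count_size _ _)) ?size_iota.
  rewrite cP; apply: (@leq_trans (t + t * r)); last by clear; lia.
  by rewrite leq_add2l leq_mul2l h orbT.
apply: (@path_multipartite_bump G t r i A p) => //.
  move=> k kr ki; have kks : k \in ks by rewrite ksP kr.
  by have [_ -> jA] := AP k kks.
by move=> k l kr lr ki li kl; apply: AA => //; rewrite ksP ?kr ?lr.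
Qed.

Lemma cB : #|B| < b.
Proof. by have [_ _ []] := HP. Qed.

Lemma part_cover v : [\/ v \in B | exists2 i, i < r & v \in V i].
Proof.
have [_ _ [-> _] _ _] := HP; rewrite inE.
by case: bigcupP_nat => h; [right|left].
Qed.

Lemma missing_inner i v : i < r -> v \in V i ->
  #|others r V i :\: neighbors v| <= 4 * (#|V i :&: neighbors v| + b).
Proof.
move=> ir vV.
have vO : v \notin others r V i.
  apply/othersP => -[j [jr ji vj]]; have [_ Vd _ _ _] := HP.
  by have := disjointFr (Vd j i jr ir ji) vj; rewrite vV.
have richO : rich t (others r V i).
  apply: (@others_rich _ _ _ _ (n %/ E)) => // [j w jr ji wV|].
    exact: (@part_missing j).
  by apply: part_large => //; clear; lia.
have [h _] := xopt vO richO.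
apply: (@leq_trans (4 * (#|V i :&: neighbors v| + #|B|))); last first.
  by rewrite leq_mul2l leq_add2l ltnW ?cB ?orbT.
rewrite -(ler_nat R) natrM natrD.
apply: le_trans (card_le_wt _ _) _; first by move=> u; have := x4 u.
rewrite ler_pM2l //.
have h1 : (wt x (neighbors v) <= wt x (others r V i :&: neighbors v) +
    (wt x (V i :&: neighbors v) + wt x B))%R.
  apply: le_trans (_ : wt x ((others r V i :&: neighbors v) :|: ((V i :&: neighbors v) :|: B)) <= _)%R.
    apply: wtS => //; apply/fintype.subsetP => z zN; rewrite !in_setU !in_setI zN !andbT.
    have [->|[j jr zj]] := part_cover z; first by rewrite !orbT.
    have [<-|ji] := eqVneq j i; first by rewrite zj orbT.
    by apply/orP; left; apply/othersP; exists j.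
  by apply: le_trans (wtU x0 _ _) _; rewrite lerD2l wtU.
have h2 := wtID x (neighbors v) (others r V i).
have := wt_le_card x1 B; have := wt_le_card x1 (V i :&: neighbors v).
by move: h h1; rewrite h2; lra.
Qed.

Lemma rich_twins (u v : G) : u \notin neighbors v -> rich t (neighbors u) ->
  rich t (neighbors v) -> neighbors u = neighbors v.
Proof.
move=> uv ru rv.
have vu : v \notin neighbors u by move: uv; rewrite !inE adj_sym.
have [h1 h2] := xopt vu ru; have [h3 _] := xopt uv rv.
apply: h2; first by have := x4 v; lra.
by apply/eqP; rewrite eq_le h1 h3.
Qed.

Lemma rich_member i A (N0 : {set G}) m : i < r -> A \subset V i ->
  (forall v, v \in A -> neighbors v :&: (V i :|: B) = N0) ->
  (forall v, v \in A -> #|others r V i :\: neighbors v| <= m) ->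
  (2 * t + 2) ^ m.+1 <= #|A| -> exists2 v, v \in A & rich t (neighbors v).
Proof.
move=> ir AV AN Am cA; pose miss v := others r V i :\: neighbors v.
have [M0 [A' [A'A M0miss A'Q]]] := popular_core (miss := miss) Am cA.
pose N' := N0 :|: (others r V i :\: M0).
have richN' : rich t N'.
  move=> Q /A'Q[u [uA' uQ uM]]; exists u => // w wQ; rewrite inE => /orP[wN|].
    by move: wN; rewrite -(AN u) ?(fintype.subsetP A'A) // !inE => /andP[].
  by rewrite inE => /andP[wM wO]; have := uM w wQ wM; rewrite inE wO andbT negbK inE.
have [|v [vA' _ _]] := A'Q set0; first by rewrite cards0.
have vA := fintype.subsetP A'A v vA'; exists v => //.
have vV := fintype.subsetP AV v vA.
have vN' : v \notin N'.
  rewrite inE negb_or -(AN v vA) !inE adj_irrefl /= negb_and.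
  apply/orP; right; apply/othersP => -[j [jr ji vj]]; have [_ Vd _ _ _] := HP.
  by have := disjointFr (Vd j i jr ir ji) vj; rewrite vV.
have [h1 h2] := xopt vN' richN'.
rewrite -h2 //; first by have := x4 v; lra.
apply/eqP; rewrite eq_le h1 /=; apply: wtS => //; apply/fintype.subsetP => z zN.
rewrite inE -(AN v vA) in_setI zN in_setU /=.
have [->|[j jr zj]] := part_cover z; first by rewrite orbT.
have [<-|ji] := eqVneq j i; first by rewrite zj.
apply/orP; right; rewrite inE; apply/andP; split; last by apply/othersP; exists j.
apply/negP => /(fintype.subsetP (M0miss v vA')); rewrite inE zN //.
Qed.

Lemma two_matchings i j D s1 s2 : i < r -> j < r -> i != j ->
  matching [set v in V i | #|V i :&: neighbors v| <= D] s1 ->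
  matching (V j) s2 -> size s1 = t -> t + 2 * t * (4 * (D + b)) <= size s2 ->
  matchings_multipartite G t (r - 2).
Proof.
move=> ir jr ij m1 [u2 sV2 a2] z1 z2.
pose X1 := [set z in unzip1 s1 ++ unzip2 s1].
have cX1 : #|X1| <= 2 * t.
  by rewrite cardsE (leq_trans (card_size _)) // size_cat !size_map z1; clear; lia.
have [u1 sV1 a1] := m1.
have X1V v : v \in X1 -> v \in V i /\ #|V i :&: neighbors v| <= D.
  by rewrite inE => /sV1; rewrite inE => /andP[].
pose Bad := \bigcup_(u in X1) (V j :\: neighbors u).
have cBad : #|Bad| <= 2 * t * (4 * (D + b)).
  apply: leq_trans (leq_mul cX1 (leqnn _)); rewrite -sum_nat_const.
  apply: (@leq_trans (\sum_(u in X1) #|V j :\: neighbors u|)).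
    rewrite /Bad; elim/big_ind2: _ => [|e f g h ef gh|//]; first by rewrite cards0.
    by apply: leq_trans (leq_card_setU _ _) (leq_add _ _).
  apply: leq_sum => u /X1V[uV du].
  apply: leq_trans (leq_trans _ (missing_inner ir uV)) _; last first.
    by rewrite leq_mul2l leq_add2r du orbT.
  apply: subset_leq_card; apply: setSD; apply/fintype.subsetP => z zV.
  by apply/othersP; exists j; rewrite eq_sym.
pose good (e : G * G) := (e.1 \notin Bad) && (e.2 \notin Bad).
have cgood : t <= size (filter good s2).
  have : count (predC good) s2 <= #|Bad|.
    apply: (@leq_trans (count (mem Bad) (unzip1 s2 ++ unzip2 s2))).
      rewrite count_cat !count_map -count_predUI.
      apply: leq_trans (leq_addr _ _); apply: sub_count => e /=.
      by rewrite negb_and !negbK.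
    rewrite -size_filter -(card_uniqP (filter_uniq _ u2)).
    by apply: subset_leq_card; apply/fintype.subsetP => z; rewrite mem_filter => /andP[].
  have := count_predC good s2; rewrite size_filter; move: z2 cBad; clear; lia.
pose s3 := take t (filter good s2).
have z3 : size s3 = t by rewrite size_takel.
have sub3 : subseq s3 s2 by apply: subseq_trans (take_subseq _ _) (filter_subseq _ _).
have good3 e : e \in s3 -> good e by move=> /mem_take; rewrite mem_filter => /andP[].
have m3 : matching [set z in unzip1 s3 ++ unzip2 s3] s3.
  split; first by apply: subseq_uniq u2; apply: cat_subseq; apply: map_subseq.
    by move=> z zs; rewrite inE.
  by move=> e /(mem_subseq sub3)/a2.
have m1' : matching X1 s1 by split=> // z zs; rewrite inE.
set X3 := [set z in unzip1 s3 ++ _] in m3.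
have cX3 : #|X3| <= 2 * t.
  by rewrite cardsE (leq_trans (card_size _)) // size_cat !size_map z3; clear; lia.
have X3V v : v \in X3 -> v \in V j /\ v \notin Bad.
  rewrite inE mem_cat => /orP[] /mapP[e es ->].
    split; last by case/andP: (good3 e es).
    by apply: sV2; rewrite mem_cat map_f // (mem_subseq sub3).
  split; last by case/andP: (good3 e es).
  by apply: sV2; rewrite mem_cat orbC map_f // (mem_subseq sub3).
have j13 : joined X1 X3.
  move=> u v uX /X3V[vV vB]; apply: contraNT vB => nuv; apply/bigcupP; exists u => //.
  by rewrite !inE nuv.
pose ks := [seq k <- iota 0 r | (k != i) && (k != j)].
have ksP k : (k \in ks) = [&& k < r, k != i & k != j].
  by rewrite mem_filter mem_iota andbC.
have [|||| A [AP AA]] := @greedy_parts G (n %/ E) t ks V (X1 :|: X3).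
- by rewrite filter_uniq ?iota_uniq.
- move=> v l; rewrite in_setU ksP => + /and3P[lr li lj].
  case/orP => [/X1V[vV _]|/X3V[vV _]].
    by apply: (@part_missing i) => //; rewrite eq_sym.
  by apply: (@part_missing j) => //; rewrite eq_sym.
- move=> k l v; rewrite !ksP => /and3P[kr _ _] /and3P[lr _ _] kl vV.
  exact: (@part_missing k).
- move=> l; rewrite ksP => /and3P[lr _ _]; apply: ltnW; apply: part_large => //.
  have h : size ks <= r by rewrite size_filter (leq_trans (count_size _ _)) ?size_iota.
  apply: (@leq_trans (#|X1| + #|X3| + t * r)).
    by apply: leq_add; [exact: leq_of_leqif (leq_card_setU _ _)|rewrite leq_mul2l h orbT].
  by move: cX1 cX3; clear; lia.
pose f k := bump i (bump (unbump i j) k).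
have Ej : bump i (unbump i j) = j by rewrite unbumpK // inE eq_sym.
have fP k : k < r - 2 -> f k \in ks.
  move=> kr; rewrite ksP /f; apply/and3P; split.
  - by rewrite /bump; case: leqP; case: leqP => /=; move: kr r2; clear; lia.
  - by rewrite eq_sym neq_bump.
  - by rewrite -[X in _ != X]Ej (can_eq (bumpK i)) eq_sym neq_bump.
exists s1, s3, (fun k => A (f k)); split=> //.
- exists X1, X3; split=> // k /fP kks; have [_ _ jA] := AP _ kks.
  by split; apply: joinedS jA => //; [apply: subsetUl|apply: subsetUr].
- by move=> k /fP kks; have [_ -> _] := AP _ kks.
- move=> k l /fP kks /fP lks kl; apply: AA => //.
  by rewrite (can_eq (bumpK _)) (can_eq (bumpK _)).
Qed.

Let D0 := 8 * t.
Let m0 := 4 * (D0 + b).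
Let K := 2 ^ b * (2 * t + 2) ^ m0.+1.
Let L := 2 ^ t * K + t.
Let Dh := 16 * t * L.
Let M := t + 2 * t * (4 * (Dh + b)).
Let c := 2 * M + K + L * (2 * M).
Hypotheses (nc : 64 * r * c <= n) (nEc : 10 * E * c < n).

Lemma part_dichotomy i : i < r ->
  (exists2 s, matching [set v in V i | #|V i :&: neighbors v| <= Dh] s & size s = M) \/
  (exists C, [/\ C \subset V i, #|V i :\: C| <= 2 * c &
     forall v, v \in C -> neighbors v = ~: V i]).
Proof.
move=> ir; set S := [set v in V i | _].
have [[s ms ss]|[K0 [K0S cK0 K0ind]]] := matching_or_cover S M; first by left; exists s.
right; have npf := part_path_free ir.
pose d v := #|V i :&: neighbors v|.
pose Z := [set v in V i | 0 < d v].
have ZV : Z \subset V i by apply/fintype.subsetP => v; rewrite inE => /andP[].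
have K0V : K0 \subset V i.
  by apply: fintype.subset_trans K0S _; apply/fintype.subsetP => v; rewrite inE => /andP[].
have npfZ : ~ has_path t Z by move/(has_pathS ZV).
have dZ v : v \in V i -> d v = #|Z :&: neighbors v|.
  move=> vV; apply: eq_card => z; rewrite !inE; case: (boolP (z \in V i)) => //= zV.
  case: (boolP (adj v z)) => vz; rewrite ?andbF // andbT.
  by apply/esym/card_gt0P; exists v; rewrite !inE vV adj_sym.
have high k : k * #|[set v in V i | k < d v]| <= 2 * t * #|Z|.
  have := path_free_high_degree 1 k npfZ; rewrite mul1n; apply: leq_trans.
  rewrite leq_mul2l; apply/orP; right; apply: subset_leq_card.
  apply/fintype.subsetP => v; rewrite !inE => /andP[vV kd]; rewrite vV mul1n -dZ // kd.
  by rewrite (leq_trans _ kd).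
pose H := [set v in V i | Dh < d v] :|: K0.
pose Low := [set v in V i | d v <= D0].
pose Y := Low :\: K0.
have YV : Y \subset V i by apply/fintype.subsetP => v; rewrite !inE => /and3P[].
have HV : H \subset V i.
  by rewrite subUset K0V andbT; apply/fintype.subsetP => v; rewrite !inE => /andP[].
have K_pos : 0 < K by rewrite muln_gt0 !expn_gt0 addn2.
have L_pos : 0 < L by rewrite /L; lia.
have D0Dh : D0 <= Dh by rewrite /D0 /Dh; move: L_pos; clear; nia.
have YS v : v \in Y -> v \in S :\: K0.
  rewrite !inE => /and3P[-> -> dv] /=; exact: leq_trans dv D0Dh.
have YH v : v \in Y -> V i :&: neighbors v = H :&: neighbors v.
  move=> vY; apply/setP => z; rewrite !in_setI.
  case: (boolP (z \in neighbors v)); rewrite ?andbF // !andbT inE => vz.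
  apply/idP/idP => [zV|/(fintype.subsetP HV)//]; rewrite !inE zV /=.
  case: (boolP (z \in K0)) => zK; rewrite ?orbT // orbF ltnNge; apply/negP => zd.
  have zS : z \in S :\: K0 by rewrite !inE zK zV.
  by have := K0ind _ _ (YS v vY) zS; rewrite vz.
have Yind u v : u \in Y -> v \in Y -> ~~ adj u v by move=> /YS uS /YS vS; apply: K0ind.
have Ymiss v : v \in Y -> #|others r V i :\: neighbors v| <= m0.
  rewrite !inE => /and3P[_ vV dv]; apply: leq_trans (missing_inner ir vV) _.
  by rewrite leq_mul2l leq_add2r dv orbT.
pose Yr := [set v in Y | `[< rich t (neighbors v) >]].
pose Yn := Y :\: Yr.
have tr_bound (tr : {set G}) : #|[set y in Yn | H :&: neighbors y == tr]| <= K.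
  rewrite leqNgt; apply/negP => big.
  have fB y : y \in [set y in Yn | H :&: neighbors y == tr] -> B :&: neighbors y \in powerset B.
    by rewrite powersetE subsetIl.
  have [|trB _ big2] := pigeonhole (m := (2 * t + 2) ^ m0.+1) fB.
    rewrite card_powerset; apply: leq_ltn_trans big; rewrite mulnC leq_mul2r leq_exp2l //.
    by rewrite (ltnW cB) orbT.
  set A := [set _ in _ | _] in big2.
  have AY v : v \in A -> [/\ v \in Yn, H :&: neighbors v = tr & B :&: neighbors v = trB].
    by rewrite inE => /andP[]; rewrite inE => /andP[-> /eqP -> /eqP ->].
  have YnY v : v \in Yn -> v \in Y by rewrite inE => /andP[].
  have [||||v vA rv] := @rich_member i A (tr :|: trB) m0 ir; last first.
  - have [] := AY v vA; rewrite inE => /andP[+ vY] _ _; rewrite inE vY /=.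
    by move/asboolP.
  - exact: ltnW.
  - by move=> v /AY[/YnY vY _ _]; apply: Ymiss.
  - move=> v /AY[/YnY vY <- <-]; rewrite -(YH v vY) setIC setIUl //.
  - by apply/fintype.subsetP => v /AY[/YnY/(fintype.subsetP YV)].
have cYn : #|Yn| <= K + L * #|H|.
  pose Y0 := [set y in Yn | H :&: neighbors y == set0].
  have : #|Yn| = #|Y0| + #|Yn :\: Y0|.
    by rewrite -(cardsID Y0 Yn) (setIidPr _) //; apply/fintype.subsetP => y; rewrite inE => /andP[].
  have : #|Y0| <= K by apply: tr_bound.
  have : #|Yn :\: Y0| <= L * #|H|.
    apply: (few_traces npf HV).
    - by apply/fintype.subsetP => y; rewrite !inE => /and3P[_ _ /and3P[_ ->]].
    - move=> y; rewrite inE => /andP[+ yn]; rewrite inE yn //.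
    - move=> tr; apply: leq_trans (tr_bound tr); apply: subset_leq_card.
      by apply/fintype.subsetP => y; rewrite !inE -!andbA => /and3P[_ -> ].
  by lia.
have cH : Dh * #|H| <= 2 * t * #|Z| + Dh * (2 * M).
  have := leq_of_leqif (leq_card_setU [set v in V i | Dh < d v] K0) => h.
  have := leq_mul (leqnn Dh) h; have := leq_mul (leqnn Dh) cK0; have := high Dh.
  by rewrite /H; clear; lia.
have cLH : 8 * (L * #|H|) <= #|Z| + 8 * (L * (2 * M)).
  have t16 : 0 < 2 * t by lia.
  rewrite -(leq_pmul2l t16); move: cH; rewrite /Dh; clear; lia.
have cLow : 4 * #|V i :\: Low| <= #|Z|.
  have := high D0; rewrite (_ : [set v in V i | D0 < d v] = V i :\: Low); last first.
    by apply/setP => v; rewrite !inE; case: (v \in V i); rewrite ?andbF //= andbT ltnNge.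
  by move=> h; rewrite -(@leq_pmul2l (2 * t)); [move: h; rewrite /D0; clear; lia|lia].
have cVYr : 8 * #|V i :\: Yr| <= 3 * #|Z| + 8 * c.
  have : #|V i :\: Yr| <= #|V i :\: Low| + (#|K0| + #|Yn|).
    apply: leq_trans (_ : #|(V i :\: Low) :|: (K0 :|: Yn)| <= _).
      apply: subset_leq_card; apply/fintype.subsetP => v; rewrite !in_setU !in_setD => /andP[-> ->].
      by case: (v \in Low) => //=; case: (v \in K0).
    by do 2!(apply: leq_trans (leq_card_setU _ _) _; rewrite ?leq_add2l).
  by move: cLow cLH cYn cK0; rewrite /c; clear; lia.
have [Vn Vd _ Vio hubs] := HP.
have cV := Vn i ir; rewrite -/n in cV.
have cZV : #|Z| <= #|V i| by apply: subset_leq_card.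
have YrV : Yr \subset V i.
  by apply: fintype.subset_trans YV; apply/fintype.subsetP => v; rewrite inE => /andP[].
have cYr : n <= 16 * r * #|Yr|.
  have := cardsID Yr (V i); rewrite (setIidPr YrV) => e1.
  have cc : 8 * c <= #|V i|.
    rewrite -(@leq_pmul2l (8 * r)); last by move: r2; clear; lia.
    apply: leq_trans cV; move: nc; clear; lia.
  have : #|V i| <= 2 * #|Yr| by move: cVYr cZV cc; rewrite -e1; clear; lia.
  by move/(leq_mul (leqnn (8 * r))); move: cV; clear; lia.
have n0 : 0 < n by move: nEc; clear; lia.
have [v0 v0Y] : exists v0, v0 \in Yr.
  by apply/card_gt0P; rewrite lt0n; apply/eqP => h; move: cYr n0; rewrite h muln0; clear; lia.
have Yrich v : v \in Yr -> v \in Y /\ rich t (neighbors v).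
  by rewrite inE => /andP[-> /asboolP].
have twin v : v \in Yr -> neighbors v = neighbors v0.
  move=> /Yrich[vY rv]; have [v0Y' rv0] := Yrich v0 v0Y.
  by apply: rich_twins => //; rewrite inE Yind.
have E16 : 16 * r < E by move: Er r2 t0; clear; nia.
have no_inner w : w \in V i -> w \notin neighbors v0.
  move=> wV; apply/negP => wv0; have [h _] := Vio i w ir wV.
  have : #|Yr| <= #|V i :&: neighbors w|.
    apply: subset_leq_card; apply/fintype.subsetP => v vY.
    by rewrite inE (fintype.subsetP YrV v vY) inE adj_sym; move: wv0; rewrite -(twin v vY) inE.
  move=> h2; have := leq_mul (leqnn E) h2 => h3.
  have h4 : 0 < #|Yr| by apply/card_gt0P; exists v0.
  by move: h h3 cYr E16 h4; rewrite -/n; clear; nia.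
have ZYr : Z \subset V i :\: Yr.
  apply/fintype.subsetP => z zZ; rewrite inE (fintype.subsetP ZV z zZ) andbT.
  apply/negP => zY; move: zZ; rewrite inE => /andP[_ /card_gt0P[w]].
  by rewrite inE (twin z zY) => /andP[/no_inner/negPf->].
have cVYr2 : #|V i :\: Yr| <= 2 * c by have := subset_leq_card ZYr; move: cVYr; clear; lia.
exists Yr; split=> // v vY; rewrite (twin v vY); apply/setP => w; rewrite [RHS]inE.
apply/idP/idP => [|wV]; first by apply: contraTN => /no_inner.
apply/negPn/negP => wv0.
have [wB|[j jr wj]] := part_cover w.
  have : #|V i :&: neighbors w| <= #|V i :\: Yr|.
    apply: subset_leq_card; apply/fintype.subsetP => u; rewrite !in_setI in_setD => /andP[-> wu].
    rewrite andbT; apply/negP => uY; move: wv0; rewrite -(twin u uY) !inE adj_sym.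
    by move: wu; rewrite inE => ->.
  move=> h; have := hubs i w ir wB; have := leq_mul (leqnn (5 * E)) (leq_trans h cVYr2).
  by rewrite -/n; move: nEc; clear; lia.
have ji : j != i by apply: contraNneq wV => <-.
have [_ h] := Vio j w jr wj.
have : #|Yr| <= #|others r V j :\: neighbors w|.
  apply: subset_leq_card; apply/fintype.subsetP => u uY; rewrite inE; apply/andP; split.
    by move: wv0; rewrite -(twin u uY) !inE adj_sym.
  by apply/othersP; exists i; rewrite eq_sym; split=> //; apply: (fintype.subsetP YrV).
move=> h2; have := leq_mul (leqnn E) h2 => h3.
have h4 : 0 < #|Yr| by apply/card_gt0P; exists v0.
by move: h h3 cYr E16 h4; rewrite -/n; clear; nia.
Qed.

End Parts.

From mathcomp Require Import classical_sets filter boolp.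

(** * Comparison with the Turan graph *)

Lemma chromatic_number_gt (H : sgraph) r : r < chromatic_number H -> ~~ colorable H r.
Proof.
rewrite /chromatic_number; case: ex_minnP => k _ kmin; rewrite ltnNge.
by apply: contra; apply: kmin.
Qed.

Lemma turan_colorable n r (H : sgraph) : 0 < r -> contains (turan_graph n r) H -> colorable H r.
Proof.
case: r => // r _ [f _ fa]; apply/existsP.
have fr v : f v %% r.+1 < r.+1 by rewrite ltn_mod.
exists [ffun v => Ordinal (fr v)]; apply/forallP => u; apply/forallP => v; apply/implyP => uv.
by rewrite !ffunE; have := fa u v uv; rewrite /= /turan_rel; apply: contraNneq => /(congr1 val)/= ->.
Qed.

Lemma turan_free n r (I : finType) (F : I -> sgraph) : 0 < r ->
  (forall i, r < chromatic_number (F i)) -> family_free F (turan_graph n r).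
Proof. by move=> r0 chi i /(turan_colorable r0); apply/negP/chromatic_number_gt. Qed.

Lemma card_turan n r : 0 < r -> #|turan_graph n r| = n.
Proof. by case: r => // r _; rewrite card_ord. Qed.

Lemma turan_nonneighbors n r (v : turan_graph n r) : 0 < r ->
  #|~: neighbors v| <= (n %/ r).+1.
Proof.
case: r v => // r v _; pose f (w : 'I_n) : 'I_(n %/ r.+1).+1 := inord (w %/ r.+1).
rewrite -[X in _ <= X]card_ord -(@card_in_imset _ _ f) ?max_card // => w z.
have fE (u : 'I_n) : f u = u %/ r.+1 :> nat.
  by rewrite inordK // ltnS leq_div2r // ltnW.
rewrite !inE /= /turan_rel !negbK => /eqP wv /eqP zv /(congr1 val) /=.
rewrite !fE => wz; apply: val_inj => /=.
by rewrite (divn_eq w r.+1) (divn_eq z r.+1) wz -wv zv.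
Qed.

Section Assembly.
Local Open Scope ring_scope.
Variable R : realType.

Lemma spectral_radius_turan n r : (0 < n)%N -> (0 < r)%N ->
  turan_density R r * n%:R - 1 <= spectral_radius R (turan_graph n r).
Proof.
move=> n0 r0; set G := turan_graph n r.
have cG : #|G| = n by apply: card_turan.
have G0 : (0 < #|G|)%N by rewrite cG.
have [x [_ _ _ _ /(_ (fun=> 1))]] := top_rayleighP R (@adj_sym G) (@adj_irrefl G) G0.
rewrite -spectral_radiusE // quadE /sqnorm.
under eq_bigr do rewrite mul1r adjsum_adj sumr_const.
under [X in _ <= _ * X]eq_bigr do rewrite expr1n.
rewrite sumr_const cG => h; rewrite -(ler_pM2r (_ : 0 < n%:R :> R)) ?ltr0n //.
apply: le_trans h.
apply: le_trans (_ : \sum_(u : G) (turan_density R r * n%:R - 1) <= _).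
  by rewrite sumr_const cG -[leRHS]mulr_natr.
apply: ler_sum => u _.
have := cardsC (neighbors u); rewrite cG => /(congr1 (fun k => k%:R : R)).
rewrite natrD => E1; have := turan_nonneighbors u r0.
rewrite -(ler_nat R) -natr1 => E2.
have E3 : (n %/ r)%:R <= n%:R / r%:R :> R.
  by rewrite ler_pdivlMr ?ltr0n // -natrM ler_nat leq_divM.
rewrite /turan_density mulrBl mul1r mulrC; lra.
Qed.

Lemma perron_vector (G : sgraph) : (0 < #|G|)%N -> 0 < spectral_radius R G ->
  exists x : G -> R, [/\ forall u, 0 <= x u, forall u, x u <= 1, exists u, x u = 1 &
    forall u, wt x (neighbors u) = spectral_radius R G * x u].
Proof.
move=> G0 rho0.
have [x [_ x0 x1 xe _]] := top_rayleighP R (@adj_sym G) (@adj_irrefl G) G0.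
rewrite -spectral_radiusE // in xe.
have [u0 _] : exists u, u \in G by apply/card_gt0P.
have [u _ umax] := @Order.TotalTheory.arg_maxP _ _ _ u0 xpredT x isT.
have xu : 0 < x u.
  rewrite lt_def x0 andbT; apply/eqP => xu0; move: x1.
  rewrite /sqnorm big1 => [/eqP|v _]; first by rewrite eq_sym oner_eq0.
  have /eqP -> : x v == 0 by rewrite eq_le x0 andbT -{1}xu0; exact: umax.
  by rewrite expr0n.
exists (fun v => x v / x u); split=> [v|v||v].
- by rewrite divr_ge0 // ltW.
- by rewrite ler_pdivrMr // mul1r; exact: umax.
- by exists u; rewrite divff // gt_eqF.
- by rewrite /wt -mulr_suml -adjsum_adj xe mulrA.
Qed.

End Assembly.

Theorem theorem1p4 (R : realType) (I : finType) (F : I -> sgraph) (r t : nat)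
    (hr : 3 <= r.+1)
    (hchi : min_chromatic F r.+1)
    (ht : t = \max_(i : I) #|F i|)
    (hF1 : exists i : I,
      contains (join (path_graph t) (turan_graph (t * (r - 1)) (r - 1))) (F i))
    (hF2 : exists i : I,
      contains (join (copies t (complete_graph 2))
                 (join (copies t (complete_graph 2))
                   (turan_graph (t * (r - 2)) (r - 2)))) (F i)) :
  exists (M0 : nat) (g : nat -> nat),
    (g @ \oo --> \oo)%classic /\
    (\forall n \near \oo%classic, forall G : sgraph, SPEX R n F G ->
      exists S : 'I_r -> {set G},
        [/\ \bigcup_(i < r) S i = [set: G],
            (forall i j : 'I_r, i != j -> [disjoint S i & S j]),
            (forall i : 'I_r, g n <= #|S i|) &
            (forall i : 'I_r, 0 < i ->
              exists S' : {set G},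
                [/\ S' \subset S i,
                    #|S i :\: S'| <= M0 &
                    forall v : G, v \in S' -> neighbors v = ~: S i])]).
Proof.
have r2 : 2 <= r by [].
have r0 : 0 < r by apply: ltnW.
have chi i : r < chromatic_number (F i) by have [_] := hchi; apply.
have Ft i : #|F i| <= t by rewrite ht; apply: leq_bigmax.
have t0 : 0 < t.
  have [[i _] _] := hchi; apply: leq_trans (Ft i); rewrite lt0n.
  apply: contraNneq (chromatic_number_gt (chi i)) => F0.
  apply/existsP; exists [ffun=> Ordinal r0]; apply/forallP => u.
  by have := card0_eq F0 u; rewrite inE.
pose E := 128 * r * (t + t * r).
pose b := t * (2 * (5 * E)) ^ r.
pose q := 16 * (5 * E) * 2 ^ b * (t + t * r).
pose L := 2 ^ t * (2 ^ b * (2 * t + 2) ^ (4 * (8 * t + b)).+1) + t.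
pose Dh := 16 * t * L.
pose M := t + 2 * t * (4 * (Dh + b)).
pose c := 2 * M + 2 ^ b * (2 * t + 2) ^ (4 * (8 * t + b)).+1 + L * (2 * M).
have E0 : 0 < E by rewrite !muln_gt0 r0 addn_gt0 t0.
have rq : r <= q.
  rewrite /q; set X := 2 ^ b; have X0 : 0 < X by rewrite expn_gt0.
  clearbody X; move: E0 t0 X0; clear; nia.
have [n0 n0P] := spectral_near_turan R t0 r2 rq.
exists (2 * c), (fun n => n %/ (8 * r)); split.
  move=> A [N _ NA]; exists (8 * r * N) => // n /= nN; apply: NA => /=.
  by rewrite leq_divRL ?muln_gt0 ?r0 // mulnC.
exists (n0 + q + 32 + 40 * E + 64 * r * c + 10 * E * c + 1) => // n /= nbig G SG.
have [Gn Gfree Gmax] := SG.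
have npm : ~ path_multipartite G t r.-1.
  have [i Fi] := hF1; move/contains_path_turan; rewrite -subn1 => Gi.
  exact: (Gfree i (contains_trans Gi Fi)).
have nmm : ~ matchings_multipartite G t (r - 2).
  have [i Fi] := hF2; move/contains_matchings_turan => Gi.
  exact: (Gfree i (contains_trans Gi Fi)).
have G0 : 0 < #|G| by rewrite Gn; move: nbig; clear; lia.
have rho : (turan_density R r * #|G|%:R - 1 <= spectral_radius R G)%R.
  apply: le_trans (spectral_radius_turan R G0 r0) _.
  by apply: Gmax; [rewrite card_turan|apply: turan_free].
have rho4 : (#|G|%:R <= 4 * spectral_radius R G)%R.
  have a2 := turan_density_ge R r2.
  have n4 : (4 <= #|G|%:R :> R)%R by rewrite ler_nat Gn; move: nbig; clear; lia.
  have : (0 <= (turan_density R r - 1 / 2) * #|G|%:R)%R by rewrite mulr_ge0 // subr_ge0.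
  lra.
have rho0 : (0 < spectral_radius R G)%R.
  by have n4 : (0 < #|G|%:R :> R)%R; [rewrite ltr0n|lra].
have [x [x0 x1 xmax xe]] := perron_vector G0 rho0.
have xopt := spex_optimal G0 Ft SG erefl rho0 x0 xe.
have [|V0 NT] := n0P G _ npm rho; first by rewrite Gn; move: nbig; clear; lia.
have E10 : 10 * r <= E by rewrite /E; move: t0; clear; nia.
have Gq : q + 32 <= #|G| by rewrite Gn; move: nbig; clear; lia.
have [V [B HP]] := hub_partition_exists x0 x1 xmax xe rho4 xopt r2 t0 E10 (leqnn _) Gq npm NT.
have qE : [/\ 32 <= q, 16 * r * t <= q & r <= q].
  have : 16 * E * (t + t * r) <= q.
    apply: leq_trans (_ : 16 * (5 * E) * (t + t * r) <= _).
      by rewrite leq_mul2r leq_mul2l leq_pmull ?orbT.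
    by rewrite /q [leqRHS]mulnAC leq_pmulr // expn_gt0.
  by move: t0 r2 E0; rewrite /E; clear; split; nia.
have [q32 qrt _] := qE.
have G32 : 32 <= #|G| by move: Gq; clear; lia.
have Gqrt : 16 * r * t < #|G| by move: Gq qrt; clear; lia.
have x4 u : (1 <= 4 * x u)%R := weight_lower x0 x1 r2 q32 qrt G32 Gqrt NT xe rho4 xopt xmax u.
have nE : 40 * E <= #|G| by rewrite Gn; move: nbig; clear; lia.
have nc : 64 * r * c <= #|G| by rewrite Gn; move: nbig; clear; lia.
have nEc : 10 * E * c < #|G| by rewrite Gn; move: nbig; clear; lia.
have dich i : i < r -> _ := @part_dichotomy R G x r t E b V B x0 x1 x4 xopt r2 t0 (leqnn _) npm HP nE nc nEc i.
pose rich_part i := exists2 s, matching [set v in V i | #|V i :&: neighbors v| <= Dh] s & size s = M.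
have [i0 i0r i0P] : exists2 i0, i0 < r & forall i, i < r -> i != i0 -> ~ rich_part i.
  have [[i0 [i0r [s1 m1 z1]]]|none] := pselect (exists i, i < r /\ rich_part i); last first.
    by exists 0 => // i ir _ ri; apply: none; exists i.
  exists i0 => // j jr ji [s2 m2 z2]; apply: nmm.
  have [u1 sV1 a1] := m1.
  have mt : matching [set v in V i0 | #|V i0 :&: neighbors v| <= Dh] (take t s1).
    have sub : subseq (take t s1) s1 by apply: take_subseq.
    split; first by apply: subseq_uniq u1; apply: cat_subseq; apply: map_subseq.
      move=> z; rewrite mem_cat => /orP[] /mapP[e es ->]; apply: sV1; rewrite mem_cat.
        by rewrite map_f // (mem_subseq sub).
      by rewrite orbC map_f // (mem_subseq sub).
    by move=> e /(mem_subseq sub)/a1.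
  have mj : matching (V j) s2.
    have [u2 sV2 a2] := m2; split=> // z /sV2.
    by rewrite inE => /andP[].
  apply: (@two_matchings R G x r t E b V B x0 x1 x4 xopt r2 t0 (leqnn _) HP nE i0 j Dh _ s2) => //.
  - by rewrite eq_sym.
  - exact: mt.
  - by rewrite size_takel // z1 leq_addr.
  - by rewrite z2.
have [Vn Vd [EB _] _ _] := HP.
pose sw k := if k == 0 then i0 else if k == i0 then 0 else k.
have swr k : k < r -> sw k < r by rewrite /sw; do ?case: ifP.
have sw_inj k l : sw k = sw l -> k = l.
  by rewrite /sw; do ?(case: eqP => ?); lia.
have swK k : sw (sw k) = k.
  rewrite {2}/sw; have [->|k0] := eqVneq k 0; first by rewrite /sw eqxx; case: eqP.
  by have [->|k1] := eqVneq k i0; rewrite // /sw (negPf k0) (negPf k1).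
pose S (k : 'I_r) := V (sw k) :|: (if k == 0 :> nat then B else finset.set0).
have VB i : i < r -> [disjoint V i & B].
  move=> ir; rewrite EB finset.disjoints_subset finset.setCK; apply/fintype.subsetP => z zi.
  by apply/bigcupP_nat; exists i.
exists S; split.
- apply/finset.setP => z; rewrite inE; apply/finset.bigcupP.
  have [zB|[i ir zi]] := part_cover HP z.
    by exists (Ordinal r0) => //; rewrite inE eqxx zB orbT.
  by exists (Ordinal (swr i ir)) => //; rewrite inE /= swK zi.
- move=> k l kl; have skl : sw k != sw l by apply: contraNneq kl => /sw_inj/val_inj->.
  have VV := Vd _ _ (swr k (ltn_ord k)) (swr l (ltn_ord l)) skl.
  have inB (m : 'I_r) z : z \in (if m == 0 :> nat then B else finset.set0) -> m = 0 :> nat /\ z \in B.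
    by case: eqP => [-> //|_]; rewrite inE.
  rewrite disjoint_subset; apply/fintype.subsetP => z; rewrite /S inE [in X in _ -> X]inE inE.
  move=> zk; apply/negP => zl; case/orP: zk => [zk|/inB[k0 zB]]; case/orP: zl => [zl|/inB[l0 zB']].
  + by rewrite (disjointFr VV zk) in zl.
  + by rewrite (disjointFr (VB _ (swr k (ltn_ord k))) zk) in zB'.
  + by rewrite (disjointFr (VB _ (swr l (ltn_ord l))) zl) in zB.
  + by move/eqP: kl; apply; apply: val_inj; rewrite /= k0 l0.
- move=> k; rewrite -Gn; apply: leq_trans (_ : #|V (sw k)| <= _); last first.
    by apply: subset_leq_card; apply: finset.subsetUl.
  have := Vn (sw k) (swr k (ltn_ord k)) => h.
  by apply: leq_trans (leq_div2r _ h) _; rewrite mulKn // muln_gt0 r0.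
move=> k k0; have kS : S k = V (sw k) by rewrite /S gtn_eqF // finset.setU0.
have ski : sw k != i0.
  have kn0 : (k == 0 :> nat) = false by apply: gtn_eqF.
  rewrite /sw kn0; case: (boolP (k == i0 :> nat)) => [/eqP <-|//].
  by rewrite eq_sym kn0.
rewrite kS; case: (dich _ (swr k (ltn_ord k))) => [h|[C [CV cC CN]]].
  by case: (i0P _ (swr k (ltn_ord k)) ski).
by exists C.
Qed.
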